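(* Suppose $X$ and $Y$ are subproduct systems over $\mathbb N^2$, and $\phi:\mathcal A_X\to\mathcal A_Y$ is a bounded isomorphism. Then: (a) $m_X+n_X=m_Y+n_Y$. (b) The character $\phi^*(\alpha_0^Y)$, when seen as a vector in $\Omega^{m_X,n_X}(J_X)$, is a root of multiplicity at least $k_Y$ of every polynomial in $J_X$.
   Context: $\mathbb N=\{0,1,2,\dots\}$. A subproduct system (over $\mathbb N^2$) is a family $X=\{X(s)\}_{s\in\mathbb N^2}$ of finite-dimensional complex Hilbert spaces with $\dim X(0)=1$ (so $X(0)=\mathbb C$), together with coisometries $U_{s,t}:X(s)\otimes X(t)\to X(s+t)$, such that $U_{s,0},U_{0,s}$ are the natural isomorphisms and $U_{s+t,r}(U_{s,t}\otimes I_{X(r)})=U_{s,t+r}(I_{X(s)}\otimes U_{t,r})$ for all $s,t,r$. Put $m_X=\dim X(1,0)$, $n_X=\dim X(0,1)$. $\mathcal F_X=\bigoplus_{s}X(s)$ (Hilbert direct sum). For $\eta\in X(s)$, $L^{(s)}_\eta\in B(\mathcal F_X)$ is given by $L^{(s)}_\eta\xi=U_{s,t}(\eta\otimes\xi)$ for $\xi\in X(t)$. The tensor algebra $\mathcal A_X$ is the norm-closed subalgebra of $B(\mathcal F_X)$ generated by all $L^{(s)}_\eta$. $\mathcal M(\mathcal A_X)$ is its space of characters (nonzero multiplicative linear functionals). $\phi:\mathcal A_X\to\mathcal A_Y$ induces $\phi^*:\mathcal M(\mathcal A_Y)\to\mathcal M(\mathcal A_X)$, $\phi^*(\alpha)=\alpha\circ\phi$.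 The vacuum character $\alpha_0^Y\in\mathcal M(\mathcal A_Y)$ is the unique character vanishing on all $L^{(1,0)}_e$, $L^{(0,1)}_f$, $e\in Y(1,0)$, $f\in Y(0,1)$. The ideal $J_X$: let $E=X(1,0)$, $F=X(0,1)$ with orthonormal bases $\{e_i\}_{i=1}^{m_X}$, $\{f_j\}_{j=1}^{n_X}$; let $M_{(i,j)}:E^{\otimes i}\otimes F^{\otimes j}\to X(i,j)$ be the coisometry obtained by composing maps $U_{s,t}$; let $u:F\otimes E\to E\otimes F$ be a unitary with $U_{(1,0),(0,1)}u=U_{(0,1),(1,0)}$ (such $u$ exist), $u(f_j\otimes e_i)=\sum_{k,l}u_{(k,l),(i,j)}e_k\otimes f_l$. Then $J_X\subset\mathbb C[z_1,\dots,z_{m_X},w_1,\dots,w_{n_X}]$ is the ideal generated by the polynomials $p_{i,j}=w_jz_i-\sum_{k,l}u_{(k,l),(i,j)}z_kw_l$ and all $q^x$ with $x\in\ker M_{(i,j)}$, $i,j\ge0$, where for $x=\sum a_{s_1\dots s_i}^{t_1\dots t_j}e_{s_1}\otimes\cdots\otimes e_{s_i}\otimes f_{t_1}\otimes\cdots\otimes f_{t_j}$ one sets $q^x=\sum a_{s_1\dots s_i}^{t_1\dots t_j}z_{s_1}\cdots z_{s_i}w_{t_1}\cdots w_{t_j}$. (A different $u$ gives the same ideal.) $\Omega^{m,n}(J)=\{(z,w)\in\mathbb C^m\times\mathbb C^n:p(z,w)=0\ \forall p\in J,\ \|z\|,\|w\|\le1\}$. The map $\alpha\mapsto(\alpha(L^{(1,0)}_{e_1}),\dots,\alpha(L^{(1,0)}_{e_{m_X}}),\alpha(L^{(0,1)}_{f_1}),\dots,\alpha(L^{(0,1)}_{f_{n_X}}))$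 is a homeomorphism of $\mathcal M(\mathcal A_X)$ (weak-* ) onto $\Omega^{m_X,n_X}(J_X)$; characters are seen as vectors via this map. $k_X$ is the minimal positive (total) degree of nonzero polynomials in $J_X$ (it does not depend on the bases; $k_X=\infty$ if $J_X=\{0\}$). A point is a root of multiplicity at least $k$ of $p$ if all partial derivatives of $p$ of order $<k$ (including $p$ itself) vanish there. *)

(* Defs.v *)
From HB Require Import structures.
From mathcomp Require Import all_boot all_order all_algebra.
From mathcomp Require Import sesquilinear complex.
From mathcomp Require Import boolp classical_sets functions cardinality.
From mathcomp Require Import fsbigop reals ereal esum.
(* The notations of mpoly clash with those of mathcomp-analysis. *)
From mathcomp Require Import -(notations) mpoly.

Set Implicit Arguments.
Unset Strict Implicit.
Unset Printing Implicit Defensive.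

Import Order.TTheory GRing.Theory Num.Theory.

Local Open Scope classical_set_scope.
Local Open Scope ring_scope.

(* Inner products are linear in the first argument. *)
Record hilbert (R : realType) := Hilbert {
  hilbert_sort :> vectType R[i];
  hdot_form : {dot hilbert_sort for Num.conj} }.

Definition hdot (R : realType) (V : hilbert R) : {dot V for Num.conj} :=
  hdot_form V.
Arguments hdot {R V}.

Definition hdim (R : realType) (V : hilbert R) : nat := \dim {:V}.

Definition hnorm2 (R : realType) (V : hilbert R) (x : V) : R :=
  complex.Re (hdot x x).

Section Hilbert.
Variable R : realType.
Local Notation C := R[i].
Implicit Types V W : hilbert R.

Definition is_onb V (e : (hdim V).-tuple V) : bool :=
  orthonormal hdot e && basis_of {:V}%VS e.

Lemma onb_exists V : exists e : (hdim V).-tuple V, is_onb e.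
Proof.
have ext k : (k <= hdim V)%N ->
    exists2 s : seq V, orthonormal hdot s & size s = k.
  elim: k => [|k IHk] ltk; first by exists [::].
  have [s os ss] := IHk (ltnW ltk).
  have [x xNs] : exists x : V, x \notin <<s>>%VS.
    apply/not_existsP => xs; have := dim_span s.
    have /eqP -> : (<<s>> == {:V})%VS.
      rewrite eqEsubv subvf; apply/subvP => x _.
      by apply/negPn/negP => /(xs x).
    by rewrite ss leqNgt ltk.
  have [y ys [z [xyz _ zs]]] := orthogonal_split hdot s x.
  have z0 : z != 0.
    by apply: contra xNs => /eqP z0; rewrite xyz z0 addr0.
  have zz0 : 0 < hdot z z by rewrite dnorm_gt0.
  pose w := (sqrtC (hdot z z))^-1 *: z.
  have ww : hdot w w = 1.
    rewrite /w dnormZ normfV ger0_norm ?sqrtC_ge0 ?ltW// exprVn sqrtCK.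
    by rewrite mulVf ?gt_eqF.
  exists (w :: s) => /=; last by rewrite ss.
  rewrite -cat1s orthonormal_cat os /orthonormal /= ww eqxx /=.
  apply/orthoPl => v vs; rewrite /w linearZl_LR /=.
  by rewrite (orthoPl zs) ?mulr0.
have [s os ss] := ext _ (leqnn _).
exists (Tuple (introT eqP ss)); rewrite /is_onb /= os /=.
by rewrite basisEfree (orthonormal_free os) /= subvf /= ss.
Qed.

Definition onb V : (hdim V).-tuple V := xchoose (onb_exists V).

Lemma onbP V : is_onb (onb V).
Proof. exact: xchooseP. Qed.

Lemma onb_dot V (e : (hdim V).-tuple V) i j :
  is_onb e -> hdot (tnth e i) (tnth e j) = (i == j)%:R.
Proof.
case/andP => /orthonormalP[ue eP] _.
rewrite eP ?mem_tnth//; congr (_%:R).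
by rewrite !(tnth_nth 0) nth_uniq ?size_tuple.
Qed.

Lemma onb_sum V (e : (hdim V).-tuple V) x :
  is_onb e -> x = \sum_i hdot x (tnth e i) *: tnth e i.
Proof.
move=> eb; have /andP[_ be] := eb.
rewrite {1}(coord_basis be (memvf x)); apply: eq_bigr => i _.
rewrite -tnth_nth; congr (_ *: _).
rewrite {2}(coord_basis be (memvf x)) linear_sumlz (bigD1 i) //=.
rewrite linearZl_LR /= -tnth_nth onb_dot// eqxx mulr1.
rewrite big1 ?addr0// => j ji.
by rewrite linearZl_LR /= -tnth_nth onb_dot// (negPf ji) mulr0.
Qed.

Lemma parseval V (e : (hdim V).-tuple V) x y : is_onb e ->
  hdot x y = \sum_i hdot x (tnth e i) * (hdot y (tnth e i))^*.
Proof.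
move=> eb; rewrite {1}(onb_sum y eb) linear_sumr.
by apply: eq_bigr => i _; rewrite linearZr_LR /= mulrC.
Qed.

Lemma hdotxx V (x : V) : hdot x x = (hnorm2 x)%:C%C.
Proof. by rewrite /hnorm2 RRe_real// ger0_real// dnorm_ge0. Qed.

Lemma hnorm2_ge0 V (x : V) : 0 <= hnorm2 x.
Proof. by rewrite -(lecR 0) -hdotxx dnorm_ge0. Qed.

Lemma hnorm20 V : hnorm2 (0 : V) = 0.
Proof. by rewrite /hnorm2 linear0l. Qed.

Lemma hnorm2Z V (a : C) (x : V) :
  hnorm2 (a *: x) = (complex.Re `|a|) ^+ 2 * hnorm2 x.
Proof.
apply/(@complexI R); rewrite -hdotxx dnormZ hdotxx rmorphM rmorphXn /=.
by rewrite RRe_real// ger0_real.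
Qed.

Lemma hnorm2D_le V (x y : V) : hnorm2 (x + y) <= 2 * (hnorm2 x + hnorm2 y).
Proof.
have : 0 <= hnorm2 (x - y) by exact: hnorm2_ge0.
have -> : hnorm2 (x - y) = 2 * (hnorm2 x + hnorm2 y) - hnorm2 (x + y).
  apply/(@complexI R).
  rewrite rmorphB rmorphM rmorph_nat rmorphD /= -!hdotxx.
  rewrite hnormB hnormD /= expr0 mul1r.
  set d := hdot x y + _; set n2 := hdot x x + _.
  by rewrite mulr_natl mulr2n [in RHS]opprD [RHS]addrA addrK.
by rewrite subr_ge0.
Qed.

Section Tensor.
Variables V W : hilbert R.

Definition tens_dot (A B : 'M[C]_(hdim V, hdim W)) : C :=
  \sum_i \sum_j A i j * (B i j)^*.

Lemma tens_dot_bilinear : bilinear_for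
  (GRing.Scale.Law.clone _ _ ( *%R ) _)
  (GRing.Scale.Law.clone _ _ (Num.conj \; *%R ) _) tens_dot.
Proof.
split=> [B|A] a x y /=; rewrite /tens_dot mulr_sumr -big_split /=;
  apply: eq_bigr => i _; rewrite mulr_sumr -big_split /=;
  apply: eq_bigr => j _; rewrite !mxE.
- by rewrite mulrDl mulrA.
- by rewrite rmorphD rmorphM mulrDr mulrCA.
Qed.

HB.instance Definition _ := bilinear_isBilinear.Build C
  'M[C]_(hdim V, hdim W) 'M[C]_(hdim V, hdim W) C
  (GRing.Scale.Law.clone _ _ ( *%R ) _)
  (GRing.Scale.Law.clone _ _ (Num.conj \; *%R ) _)
  tens_dot tens_dot_bilinear.

Lemma tens_dot_hermitian A B :
  tens_dot A B = (-1) ^+ false * (tens_dot B A)^*.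
Proof.
rewrite expr0 mul1r rmorph_sum; apply: eq_bigr => i _.
rewrite rmorph_sum; apply: eq_bigr => j _.
by rewrite rmorphM /= conjCK mulrC.
Qed.

HB.instance Definition _ := isHermitianSesquilinear.Build C
  'M[C]_(hdim V, hdim W) false Num.conj tens_dot tens_dot_hermitian.

Lemma tens_dot_gt0 A : A != 0 -> 0 < tens_dot A A.
Proof.
move=> A0; have sq_ge0 i j : 0 <= A i j * (A i j)^*.
  by rewrite -normCK exprn_ge0.
have s_ge0 i : 0 <= \sum_j A i j * (A i j)^* by rewrite sumr_ge0.
rewrite lt0r sumr_ge0// andbT; apply: contra A0 => /eqP /psumr_eq0P AA.
apply/eqP/matrixP => i j; rewrite mxE; apply/eqP.
have /psumr_eq0P := AA (fun i _ => s_ge0 i) i isT.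
move=> /(_ (fun j _ => sq_ge0 i j) j isT) /eqP.
by rewrite -normCK sqrf_eq0 normr_eq0.
Qed.

HB.instance Definition _ := isDotProduct.Build C
  'M[C]_(hdim V, hdim W) tens_dot tens_dot_gt0.

(* The Hilbert space tensor product in coordinates: the entry (i, j) of a     *)
(* matrix is the coefficient of e_i (x) f_j, for e = onb V and f = onb W.     *)
Definition tensor : hilbert R := Hilbert tens_dot.

Definition tens (x : V) (y : W) : tensor :=
  \matrix_(i, j) (hdot x (tnth (onb V) i) * hdot y (tnth (onb W) j)).

End Tensor.

Lemma tensDl V W (x x' : V) (y : W) : tens (x + x') y = tens x y + tens x' y.
Proof. by apply/matrixP => i j; rewrite !mxE linearDl mulrDl. Qed.

Lemma tensDr V W (x : V) (y y' : W) : tens x (y + y') = tens x y + tens x y'.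
Proof. by apply/matrixP => i j; rewrite !mxE linearDl mulrDr. Qed.

Lemma tensZl V W (a : C) (x : V) (y : W) : tens (a *: x) y = a *: tens x y.
Proof. by apply/matrixP => i j; rewrite !mxE linearZl_LR mulrA. Qed.

Lemma tensZr V W (a : C) (x : V) (y : W) : tens x (a *: y) = a *: tens x y.
Proof. by apply/matrixP => i j; rewrite !mxE linearZl_LR mulrCA. Qed.

Lemma hdot_tens V W (x x' : V) (y y' : W) :
  hdot (tens x y) (tens x' y') = hdot x x' * hdot y y'.
Proof.
rewrite (parseval x x' (onbP V)) (parseval y y' (onbP W)) mulr_suml.
apply: eq_bigr => i _; rewrite mulr_sumr; apply: eq_bigr => j _.
by rewrite !mxE rmorphM mulrACA.
Qed.

Lemma hnorm2_tens V W (x : V) (y : W) :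
  hnorm2 (tens x y) = hnorm2 x * hnorm2 y.
Proof. by apply/(@complexI R); rewrite rmorphM /= -!hdotxx hdot_tens. Qed.

Lemma tens_span V W (A : tensor V W) :
  A = \sum_i \sum_j A i j *: tens (tnth (onb V) i) (tnth (onb W) j).
Proof.
apply/matrixP => k l; rewrite summxE (bigD1 k) //= summxE (bigD1 l) //= !mxE.
rewrite !onb_dot ?onbP// !eqxx !mulr1 big1 ?addr0 => [|j jl]; last first.
  by rewrite !mxE !onb_dot ?onbP// (negPf jl) !mulr0.
rewrite big1 ?addr0// => i ik; rewrite summxE big1// => j _.
by rewrite !mxE !onb_dot ?onbP// (negPf ik) mul0r mulr0.
Qed.

Definition adjoint V W (T : 'Hom(V, W)) (T' : 'Hom(W, V)) : Prop :=
  forall x y, hdot (T x) y = hdot x (T' y).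

Definition coisometry V W (T : 'Hom(V, W)) : Prop :=
  exists2 T' : 'Hom(W, V), adjoint T T' & (T \o T')%VF = \1%VF.

Definition unitary V W (T : 'Hom(V, W)) : Prop :=
  exists T' : 'Hom(W, V),
    [/\ adjoint T T', (T \o T')%VF = \1%VF & (T' \o T)%VF = \1%VF].

Lemma coisometry_le V W (T : 'Hom(V, W)) x :
  coisometry T -> hnorm2 (T x) <= hnorm2 x.
Proof.
case=> T' adj TT'; have TT'E y : T (T' y) = y.
  by have /lfunP/(_ y) := TT'; rewrite comp_lfunE id_lfunE.
have : 0 <= hnorm2 (x - T' (T x)) by exact: hnorm2_ge0.
have -> : hnorm2 (x - T' (T x)) = hnorm2 x - hnorm2 (T x).
  have nC : (hdot (T x) (T x))^* = hdot (T x) (T x).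
    by rewrite [RHS]hermC expr0 mul1r.
  apply/(@complexI R); rewrite rmorphB /= -!hdotxx hnormB /= expr0 mul1r.
  by rewrite -!adj TT'E nC opprD addrA addrK.
by rewrite subr_ge0.
Qed.

Lemma hnorm2_eq0 V (x : V) : hnorm2 x = 0 -> x = 0.
Proof. by move=> x0; apply/eqP; rewrite -(dnorm_eq0 hdot) hdotxx x0. Qed.

End Hilbert.

(* The axioms on the coisometries are stated on elementary tensors, which     *)
(* span (tens_span). As dim X(0) = 1, the unit vector sp_one identifies X(0)  *)
(* with C.                                                                    *)
Record subproduct_system (R : realType) := SubproductSystem {
  sp_space :> nat * nat -> hilbert R;
  sp_mul : forall s t, 'Hom(tensor (sp_space s) (sp_space t), sp_space (s + t));
  sp_one : sp_space 0;
  sp_dim0 : hdim (sp_space 0) = 1%N;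
  sp_one1 : hdot sp_one sp_one = 1;
  sp_coisometry : forall s t, coisometry (sp_mul s t);
  sp_mul1l : forall s (x : sp_space s),
    ecast r (sp_space r) (add0r s) (sp_mul 0 s (tens sp_one x)) = x;
  sp_mul1r : forall s (x : sp_space s),
    ecast r (sp_space r) (addr0 s) (sp_mul s 0 (tens x sp_one)) = x;
  sp_mulA : forall s t r (x : sp_space s) (y : sp_space t) (z : sp_space r),
    ecast q (sp_space q) (addrA s t r)
      (sp_mul s (t + r) (tens x (sp_mul t r (tens y z)))) =
    sp_mul (s + t) r (tens (sp_mul s t (tens x y)) z) }.

Definition sp_m (R : realType) (X : subproduct_system R) : nat :=
  hdim (X (1%N, 0%N)).

Definition sp_n (R : realType) (X : subproduct_system R) : nat :=
  hdim (X (0%N, 1%N)).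

Lemma addp_inj (s : nat * nat) : injective (fun t : nat * nat => s + t).
Proof.
move=> [a b] [c d] /= st; congr pair.
- by apply: (@addnI s.1); exact: (congr1 fst st).
- by apply: (@addnI s.2); exact: (congr1 snd st).
Qed.

Section Fock.
Variables (R : realType) (X : subproduct_system R).
Local Notation C := R[i].

Definition sections := forall s, X s.

HB.instance Definition _ := gen_eqMixin sections.
HB.instance Definition _ := gen_choiceMixin sections.

Lemma sectionsP (f g : sections) : (forall s, f s = g s) -> f = g.
Proof. exact: functional_extensionality_dep. Qed.

Definition sections_add (f g : sections) : sections := fun s => f s + g s.
Definition sections_opp (f : sections) : sections := fun s => - f s.
Definition sections_zero : sections := fun s => 0.
Definition sections_scale (a : C) (f : sections) : sections :=
  fun s => a *: f s.

Lemma sections_addA : associative sections_add.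
Proof.
by move=> f g h; apply: sectionsP => s; rewrite /sections_add addrA.
Qed.

Lemma sections_addC : commutative sections_add.
Proof.
by move=> f g; apply: sectionsP => s; rewrite /sections_add addrC.
Qed.

Lemma sections_add0 : left_id sections_zero sections_add.
Proof.
by move=> f; apply: sectionsP => s; rewrite /sections_add add0r.
Qed.

Lemma sections_addN : left_inverse sections_zero sections_opp sections_add.
Proof.
by move=> f; apply: sectionsP => s; rewrite /sections_add addNr.
Qed.

HB.instance Definition _ := GRing.isZmodule.Build sections
  sections_addA sections_addC sections_add0 sections_addN.

Lemma sections_scaleA a b f :
  sections_scale a (sections_scale b f) = sections_scale (a * b) f.
Proof. by apply: sectionsP => s; rewrite /sections_scale scalerA. Qed.

Lemma sections_scale1 : left_id 1 sections_scale.
Proof.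
by move=> f; apply: sectionsP => s; rewrite /sections_scale scale1r.
Qed.

Lemma sections_scaleDr : right_distributive sections_scale +%R.
Proof.
by move=> a f g; apply: sectionsP => s; apply: scalerDr.
Qed.

Lemma sections_scaleDl f : {morph sections_scale^~ f : a b / a + b}.
Proof.
by move=> a b; apply: sectionsP => s; apply: scalerDl.
Qed.

HB.instance Definition _ := GRing.Zmodule_isLmodule.Build C sections
  sections_scaleA sections_scale1 sections_scaleDr sections_scaleDl.

Definition l2norm2 (f : sections) : \bar R :=
  (\esum_(s in [set: nat * nat]) (hnorm2 (f s))%:E)%E.

Definition square_summable : {pred sections} :=
  fun f => (l2norm2 f < +oo)%E.

Lemma le_esumZ (k : R) (a b : nat * nat -> R) : 0 <= k ->
  (forall s, a s <= k * b s) ->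
  (\esum_(s in [set: nat * nat]) (a s)%:E <=
   k%:E * \esum_(s in [set: nat * nat]) (b s)%:E)%E.
Proof.
move=> k0 ab; apply: ge_ereal_sup => _ [F [finF _] <-].
apply: (@le_trans _ _ (k%:E * \sum_(s \in F) (b s)%:E)%E).
  rewrite !fsbig_finite//= !sumEFin -EFinM lee_fin mulr_sumr.
  by apply: ler_sum.
apply: lee_wpmul2l; first by rewrite lee_fin.
by apply: ereal_sup_ubound; exists F.
Qed.

Lemma square_summable_submod : submod_closed square_summable.
Proof.
split.
  rewrite unfold_in /l2norm2 esum1 ?ltry// => s _.
  by rewrite [X in hnorm2 X](_ : _ = 0)// hnorm20.
move=> a f g; rewrite !unfold_in /l2norm2 => f2 g2.
pose k := 2 * ((complex.Re `|a|) ^+ 2 + 1) : R.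
have k0 : 0 <= k by rewrite mulr_ge0// addr_ge0// sqr_ge0.
have /le_lt_trans -> // : (\esum_(s in [set: nat * nat])
    (hnorm2 ((a *: f + g) s))%:E <= k%:E *
    \esum_(s in [set: nat * nat]) (hnorm2 (f s) + hnorm2 (g s))%:E)%E.
  apply: le_esumZ => // s; apply: (le_trans (hnorm2D_le _ _)).
  rewrite /k -mulrA ler_pM2l// hnorm2Z mulrDl mul1r lerD//.
    by rewrite ler_wpM2l ?sqr_ge0// lerDl hnorm2_ge0.
  by rewrite lerDr hnorm2_ge0.
under eq_esum do rewrite EFinD.
rewrite esumD; try by move=> *; rewrite lee_fin hnorm2_ge0.
by rewrite lte_mul_pinfty// lte_add_pinfty.
Qed.

HB.instance Definition _ :=
  GRing.isSubmodClosed.Build C sections square_summable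
    square_summable_submod.

Record fock := Fock {
  fock_val :> sections;
  fockP : fock_val \in square_summable }.

HB.instance Definition _ := [isSub for fock_val].
HB.instance Definition _ := [Choice of fock by <:].
HB.instance Definition _ := [SubChoice_isSubLmodule of fock by <:].

Definition fnorm (f : fock) : R := Num.sqrt (fine (l2norm2 f)).

Definition inc_sec s (x : X s) : sections := dfwith (0 : sections) x.

Lemma inc_subproof s (x : X s) : inc_sec x \in square_summable.
Proof.
rewrite unfold_in /l2norm2.
have -> : (\esum_(t in [set: nat * nat]) (hnorm2 (inc_sec x t))%:E =
    \esum_(t in [set s]) (hnorm2 x)%:E)%E.
  rewrite [RHS]esum_mkcond; apply: eq_esum => t _.
  have [->|ts] := eqVneq t s; first by rewrite mem_set//= /inc_sec dfwith_in.
  rewrite memNset; last by move=> /= tE; rewrite tE eqxx in ts.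
  rewrite /inc_sec dfwith_out 1?eq_sym//.
  by rewrite [X in hnorm2 X](_ : _ = 0)// hnorm20.
by rewrite esum_set1 ?ltry// lee_fin hnorm2_ge0.
Qed.

Definition inc s (x : X s) : fock := Fock (inc_subproof x).

Definition creation_sec s (eta : X s) (f : sections) : sections := fun r =>
  if (insub (r.1 - s.1, r.2 - s.2)%N : option {t | s + t == r}) is Some t then
    ecast q (X q) (eqP (valP t)) (sp_mul X s (val t) (tens eta (f (val t))))
  else 0.

Lemma creation_secE s (eta : X s) f t :
  creation_sec eta f (s + t) = sp_mul X s t (tens eta (f t)).
Proof.
have stE : ((s + t)%R.1 - s.1, (s + t)%R.2 - s.2)%N = t.
  by rewrite !addKn; case: (t).
rewrite /creation_sec stE insubT//= => st; move: (eqP _) => e.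
by rewrite (eq_axiomK e).
Qed.

Lemma creation_sec0 s (eta : X s) f r :
  (forall t, s + t != r) -> creation_sec eta f r = 0.
Proof.
move=> sr; rewrite /creation_sec; case: insubP => //= u su.
by rewrite (negPf (sr _)) in su.
Qed.

Lemma creation_subproof s (eta : X s) (f : fock) :
  creation_sec eta f \in square_summable.
Proof.
rewrite unfold_in /l2norm2.
pose P := range (fun t => s + t).
have -> : (\esum_(r in [set: nat * nat]) (hnorm2 (creation_sec eta f r))%:E =
    \esum_(r in P) (hnorm2 (creation_sec eta f r))%:E)%E.
  rewrite [RHS]esum_mkcond; apply: eq_esum => r _.
  case: ifPn => // /negP rP; rewrite creation_sec0 ?hnorm20// => t.
  by apply/eqP => tr; apply: rP; rewrite inE; exists t.
rewrite (@reindex_esum _ _ _ setT P (fun t => s + t)); last first.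
  split; [by move=> t _; exists t | | by []].
  by move=> t t' _ _ /addp_inj.
have /le_lt_trans -> // : (\esum_(t in [set: nat * nat])
    (hnorm2 (creation_sec eta f (s + t)))%:E <=
    (hnorm2 eta)%:E *
    \esum_(t in [set: nat * nat]) (hnorm2 (fock_val f t))%:E)%E.
  apply: le_esumZ => [|t]; first exact: hnorm2_ge0.
  rewrite creation_secE -hnorm2_tens; apply: coisometry_le.
  exact: sp_coisometry.
by rewrite lte_mul_pinfty ?lee_fin ?hnorm2_ge0//; apply: fockP.
Qed.

(* The operator L^(s)_eta; see creation_inc *)
Definition creation s (eta : X s) (f : fock) : fock :=
  Fock (creation_subproof eta f).

Lemma creation_inc s t (eta : X s) (xi : X t) :
  creation eta (inc xi) = inc (sp_mul X s t (tens eta xi)).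
Proof.
apply/val_inj/sectionsP => r /=.
have [[u <-]|sr] := pselect (exists u, s + u = r).
  rewrite creation_secE /inc_sec.
  have [->|ut] := eqVneq u t; first by rewrite !dfwith_in.
  rewrite dfwith_out 1?eq_sym// dfwith_out; last first.
    by apply: contra ut => /eqP /addp_inj ->.
  by rewrite [X in tens _ X](_ : _ = 0)// -(scale0r 0) tensZr scale0r linear0.
rewrite creation_sec0 => [|u]; last by apply/eqP => su; apply: sr; exists u.
by rewrite /inc_sec dfwith_out//; apply/eqP => su; apply: sr; exists t.
Qed.

Definition bounded_operator (T : fock -> fock) : Prop :=
  linear T /\ exists M : R, forall f, fnorm (T f) <= M * fnorm f.

Definition opnorm (T : fock -> fock) : R :=
  inf [set M : R | 0 <= M /\ forall f, fnorm (T f) <= M * fnorm f].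

Definition operator_algebra (A : set (fock -> fock)) : Prop :=
  [/\ A `<=` bounded_operator, A 0,
      forall S T, A S -> A T -> A (S + T),
      forall a S, A S -> A (a *: S) &
      forall S T, A S -> A T -> A (S \o T)].

Definition norm_closed (A : set (fock -> fock)) : Prop :=
  forall T, bounded_operator T ->
    (forall eps : R, 0 < eps -> exists2 S, A S & opnorm (T - S) < eps) -> A T.

Definition tensor_algebra : set (fock -> fock) :=
  smallest (fun A => operator_algebra A /\ norm_closed A)
    [set T | exists s (eta : X s), T = creation eta].

(* Functions defined on the tensor algebra are represented by functions on    *)
(* all operators, of which only the values on tensor_algebra matter.          *)
Definition is_character (alpha : (fock -> fock) -> C) : Prop :=
  [/\ forall S T, tensor_algebra S -> tensor_algebra T ->
        alpha (S + T) = alpha S + alpha T,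
      forall a S, tensor_algebra S -> alpha (a *: S) = a * alpha S,
      forall S T, tensor_algebra S -> tensor_algebra T ->
        alpha (S \o T) = alpha S * alpha T &
      exists2 T, tensor_algebra T & alpha T != 0].

Definition vacuum_character (alpha : (fock -> fock) -> C) : Prop :=
  [/\ is_character alpha,
      forall e : X (1%N, 0%N), alpha (creation e) = 0 &
      forall f : X (0%N, 1%N), alpha (creation f) = 0].

End Fock.

Definition bounded_isomorphism (R : realType) (X Y : subproduct_system R)
    (phi : (fock X -> fock X) -> (fock Y -> fock Y)) : Prop :=
  let A := tensor_algebra (X := X) in
  [/\ set_bij A (tensor_algebra (X := Y)) phi,
      forall S T, A S -> A T -> phi (S + T) = phi S + phi T,
      forall a S, A S -> phi (a *: S) = a *: phi S,
      forall S T, A S -> A T -> phi (S \o T) = phi S \o phi T &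
      exists M : R, forall S, A S -> opnorm (phi S) <= M * opnorm S].

Section Polynomials.
Variables (R : realType) (N : nat).
Local Notation C := R[i].
Local Notation poly := (mpoly N C).

Definition is_ideal (I : set poly) : Prop :=
  [/\ I 0, forall p q, I p -> I q -> I (p + q) &
      forall p q, I q -> I (p * q)].

(* mmeasure mdeg p is 1 + the total degree of p when p != 0 (cf. msize) *)
Definition total_degree (p : poly) : nat := (mmeasure (@mdeg N) p).-1.

(* The infimum of the empty set is +oo *)
Definition min_degree (I : set poly) : \bar R :=
  ereal_inf [set (d%:R)%:E | d in [set d : nat | (0 < d)%N /\
    exists p, [/\ I p, p != 0 & total_degree p = d]]].

Definition root_multiplicity_ge (k : \bar R) (p : poly) (v : 'I_N -> C) :
    Prop :=
  forall a : multinom N, (((mdeg a)%:R)%:E < k)%E -> meval v (mderivm a p) = 0.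

End Polynomials.

Section Ideal.
Variables (R : realType) (X : subproduct_system R).
Local Notation C := R[i].
Local Notation E := (X (1%N, 0%N)).
Local Notation F := (X (0%N, 1%N)).
Local Notation m := (sp_m X).
Local Notation n := (sp_n X).
Local Notation poly := (mpoly (m + n) C).

Fixpoint prod_E i (v : seq E) : X (i, 0%N) :=
  if i is i'.+1 then
    sp_mul X (1%N, 0%N) (i', 0%N) (tens (head 0 v) (prod_E i' (behead v)))
  else sp_one X.

Fixpoint prod_F j (w : seq F) : X (0%N, j) :=
  if j is j'.+1 then
    sp_mul X (0%N, 1%N) (0%N, j') (tens (head 0 w) (prod_F j' (behead w)))
  else sp_one X.

(* M_(i,j) (v_1 (x) ... (x) v_i (x) w_1 (x) ... (x) w_j), for v and w of      *)
(* lengths i and j                                                            *)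
Definition sp_M i j (v : seq E) (w : seq F) : X ((i, 0%N) + (0%N, j)) :=
  sp_mul X (i, 0%N) (0%N, j) (tens (prod_E i v) (prod_F j w)).

Definition commutation_unitary (u : 'Hom(tensor F E, tensor E F)) : Prop :=
  unitary u /\
  forall x, sp_mul X (1%N, 0%N) (0%N, 1%N) (u x) =
            sp_mul X (0%N, 1%N) (1%N, 0%N) x.

(* The choices made in the definition of J_X *)
Record frame := Frame {
  frame_e : m.-tuple E;
  frame_f : n.-tuple F;
  frame_u : 'Hom(tensor F E, tensor E F);
  frame_eP : is_onb frame_e;
  frame_fP : is_onb frame_f;
  frame_uP : commutation_unitary frame_u }.

Variable B : frame.
Local Notation e := (tnth (frame_e B)).
Local Notation f := (tnth (frame_f B)).
Local Notation u := (frame_u B).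

Definition zvar (i : 'I_m) : poly := mpolyX C (mnm1 (lshift n i)).
Definition wvar (j : 'I_n) : poly := mpolyX C (mnm1 (rshift m j)).

Definition u_coef k l i j : C :=
  hdot (u (tens (f j) (e i))) (tens (e k) (f l)).

Definition commutation_poly i j : poly :=
  wvar j * zvar i - \sum_k \sum_l u_coef k l i j *: (zvar k * wvar l).

(* Elements of E^(x)i (x) F^(x)j are given by their coefficients in the       *)
(* basis e_(s_1) (x) ... (x) e_(s_i) (x) f_(t_1) (x) ... (x) f_(t_j).         *)
Definition ker_M i j (a : i.-tuple 'I_m -> j.-tuple 'I_n -> C) : Prop :=
  \sum_s \sum_t a s t *:
    sp_M i j [seq e k | k <- s] [seq f l | l <- t] = 0.

Definition q_poly i j (a : i.-tuple 'I_m -> j.-tuple 'I_n -> C) : poly :=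
  \sum_s \sum_t a s t *: (\prod_(k <- s) zvar k * \prod_(l <- t) wvar l).

Definition J_ideal : set poly :=
  smallest (@is_ideal R (m + n))
    ([set p | exists i j, p = commutation_poly i j] `|`
     [set p | exists i j (a : i.-tuple 'I_m -> j.-tuple 'I_n -> C),
                ker_M a /\ p = q_poly a]).

Definition l2norm d (z : 'I_d -> C) : C := sqrtC (\sum_i `|z i| ^+ 2).

Definition Omega : set ('I_(m + n) -> C) :=
  [set v | [/\ forall p, J_ideal p -> meval v p = 0,
               l2norm (fun i : 'I_m => v (lshift n i)) <= 1 &
               l2norm (fun j : 'I_n => v (rshift m j)) <= 1]].

(* The vector representing the character alpha *)
Definition char_point (alpha : (fock X -> fock X) -> C) : 'I_(m + n) -> C :=
  fun k => match fintype.split k with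
           | inl i => alpha (creation (e i))
           | inr j => alpha (creation (f j))
           end.

End Ideal.

(* Main.v *)
Require Import Defs.
From mathcomp Require Import all_boot all_order all_algebra.
From mathcomp Require Import complex.
From mathcomp Require Import classical_sets reals.
From HB Require Import structures.
From mathcomp Require Import sesquilinear ring lra.
From mathcomp Require Import boolp functions cardinality fsbigop ereal esum.
From mathcomp Require Import -(notations) mpoly.
Local Open Scope ring_scope.

Set Implicit Arguments.
Unset Strict Implicit.
Unset Printing Implicit Defensive.

Import Order.TTheory GRing.Theory Num.Theory.

Local Open Scope classical_set_scope.
Local Open Scope ring_scope.

(** The tensor algebra of Y is studied through jets. For K at most the minimal
degree of J_Y the ideal contains nothing of degree less than K, so polynomials
modulo the K-th power of the ideal m of the origin form a quotient of the
tensor algebra: a homogeneous element of Fock space that is the image of a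
word e..e f..f is sent to the corresponding monomial, and an operator T is
sent to the jet of T applied to the vacuum. This map is well defined because
the kernel of M_(i,j) and the commutation relations produce elements of J_Y of
too low a degree to be nonzero; it is multiplicative modulo m^K because
creation operators of degree one act as multiplication by the variables and
generate the algebra (jet_mul). Its constant term is the vacuum character
(vacuum_character_jet).

Composed with phi, it turns the generators of the tensor algebra of X into a
tuple G of polynomials whose constant terms are the coordinates of the point
v of the theorem. The generators satisfy the relations of J_X, so p(G) = 0
modulo m^K for every p in J_X (J_ideal_vanish); the constant term of this
identity is p(v) = 0. A linear functional that kills the linear parts of all
the entries of G kills, by the Leibniz rule and continuity, the linear part of
the jet of every operator in the image of phi, hence is zero
(linear_part_separates). So the linear part of G has rank m_Y + n_Y, which is
therefore at most m_X + n_X. The inverse of phi is bounded by the open mapping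
theorem, so the roles of X and Y can be exchanged, the dimensions agree, and
the Jacobian of G at the origin is invertible. Differentiating p(G) = 0 by the
chain rule and inverting the Jacobian gives (d_i p)(G) = 0 modulo m^(K-1);
iterating, all derivatives of p of order less than K vanish at v
(mderivm_vanish).

The analysis needed is that the tensor algebra is complete. A Neumann series
then shows that every character is contractive (character_le), which bounds
the two blocks of v, and the Baire argument behind the open mapping theorem
applies (bounded_isomorphism_inverse). *)

(** * The modulus as a real number *)

Section Modulus.
Variable R : realType.
Local Notation C := R[i].
Implicit Types a b : C.

Definition cabs a : R := complex.Re `|a|.

Lemma cabsE a : (cabs a)%:C%C = `|a|.
Proof. by rewrite /cabs RRe_real// realE normr_ge0. Qed.

Lemma cabs_ge0 a : 0 <= cabs a.
Proof. by rewrite -(@lecR R) cabsE normr_ge0. Qed.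

Lemma cabs_gt0 a : (0 < cabs a) = (a != 0).
Proof. by rewrite -(@ltcR R) cabsE normr_gt0. Qed.

Lemma cabs0 : cabs 0 = 0.
Proof. by rewrite /cabs normr0. Qed.

Lemma cabsM a b : cabs (a * b) = cabs a * cabs b.
Proof. by apply/(@complexI R); rewrite rmorphM /= !cabsE normrM. Qed.

Lemma cabsV a : cabs a^-1 = (cabs a)^-1.
Proof. by apply/(@complexI R); rewrite fmorphV /= !cabsE normfV. Qed.

Lemma cabsD a b : cabs (a + b) <= cabs a + cabs b.
Proof. by rewrite -(@lecR R) rmorphD /= !cabsE ler_normD. Qed.

Lemma cabs_sum (I : Type) (r : seq I) (P : pred I) (F : I -> C) :
  cabs (\sum_(i <- r | P i) F i) <= \sum_(i <- r | P i) cabs (F i).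
Proof.
rewrite -(@lecR R) rmorph_sum /= cabsE; under [leRHS]eq_bigr do rewrite cabsE.
exact: ler_norm_sum.
Qed.

Lemma cabs_real (c : R) : cabs c%:C%C = `|c|.
Proof. by rewrite /cabs normc_def /= expr0n addr0 sqrtr_sqr. Qed.

Lemma cabs_eq0 a : (forall e : R, 0 < e -> cabs a <= e) -> a = 0.
Proof.
move=> ae; apply/eqP; rewrite -[_ == _]negbK -cabs_gt0 -leNgt.
by apply/ler_addgt0Pr => e /ae; rewrite add0r.
Qed.

End Modulus.

(** * The norm of Fock space *)

Section FockNorm.
Variables (R : realType) (X : subproduct_system R).
Local Notation C := R[i].
Implicit Types f g : fock X.

Lemma esum_leP (a : nat * nat -> R) (c : R) : (forall s, 0 <= a s) ->
  (\esum_(s in [set: nat * nat]) (a s)%:E <= c%:E)%E <->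
  (forall r, uniq r -> \sum_(s <- r) a s <= c).
Proof.
move=> a0; split=> [ac r ur|ac].
  rewrite -lee_fin; apply: le_trans ac; apply: ereal_sup_ubound.
  exists [set` r]; first by split => //; exact: finite_seq.
  by rewrite -fsbig_seq// sumEFin.
apply: ge_ereal_sup => _ [F [finF _] <-].
by rewrite fsbig_finite//= sumEFin lee_fin; apply: ac; exact: finmap.fset_uniq.
Qed.

Lemma l2norm2_ge0 f : (0 <= l2norm2 f)%E.
Proof. by apply: esum_ge0 => s _; rewrite lee_fin hnorm2_ge0. Qed.

Lemma fnorm_ge0 f : 0 <= fnorm f.
Proof. exact: sqrtr_ge0. Qed.

Lemma l2norm2E f : l2norm2 f = ((fnorm f) ^+ 2)%:E.
Proof.
have f0 := l2norm2_ge0 f; have := fockP f; rewrite unfold_in => f2.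
by rewrite sqr_sqrtr ?fine_ge0// fineK// ge0_fin_numE.
Qed.

Lemma fnorm_leP f c : 0 <= c ->
  (fnorm f <= c) <->
  (forall r, uniq r -> \sum_(s <- r) hnorm2 (fock_val f s) <= c ^+ 2).
Proof.
move=> c0; rewrite -(@ler_pXn2r _ 2) ?nnegrE ?fnorm_ge0//.
by rewrite -lee_fin -l2norm2E; apply: esum_leP => s; exact: hnorm2_ge0.
Qed.

Lemma hnorm2_le_fnorm f s : hnorm2 (fock_val f s) <= fnorm f ^+ 2.
Proof.
have /(_ [:: s] isT) := (fnorm_leP f (fnorm_ge0 f)).1 (lexx _).
by rewrite big_seq1.
Qed.



(** A real quadratic form in the real coefficients; its cross term is left
abstract so that two instances can be compared linearly. *)
Lemma hnorm2_quadratic (V : hilbert R) (x y : V) :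
  exists d : R, forall a b : R, hnorm2 (a%:C%C *: x + b%:C%C *: y) =
    a ^+ 2 * hnorm2 x + b ^+ 2 * hnorm2 y + a * b * d.
Proof.
exists (complex.Re (hdot x y + (hdot x y)^*)) => a b.
have cr (c : R) : (c%:C%C : C)^* = c%:C%C.
  by apply: conj_Creal; apply/complex_realP; exists c.
have dr : (complex.Re (hdot x y + (hdot x y)^*))%:C%C =
    hdot x y + (hdot x y)^*.
  by rewrite RRe_real// CrealE rmorphD /= conjCK addrC.
apply/(@complexI R); rewrite !rmorphD !rmorphM /= dr -!hdotxx dnormD /=.
rewrite !linearZl_LR !linearZr_LR /= !rmorphM /= !cr.
ring.
Qed.

Lemma hnorm2D_weighted (V : hilbert R) (x y : V) (a b : R) : 0 < a -> 0 < b ->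
  hnorm2 (x + y) <= (1 + b / a) * hnorm2 x + (1 + a / b) * hnorm2 y.
Proof.
move=> a0 b0; have ab0 : 0 < a * b by rewrite mulr_gt0.
have [d dE] := hnorm2_quadratic x y.
have := dE 1 1; rewrite !scale1r => ->.
have : 0 <= hnorm2 (b%:C%C *: x + (- a)%:C%C *: y) by exact: hnorm2_ge0.
rewrite dE => h; rewrite -(ler_pM2l ab0) -subr_ge0.
suff -> : a * b * ((1 + b / a) * hnorm2 x + (1 + a / b) * hnorm2 y) -
  a * b * (1 ^+ 2 * hnorm2 x + 1 ^+ 2 * hnorm2 y + 1 * 1 * d) =
  b ^+ 2 * hnorm2 x + (- a) ^+ 2 * hnorm2 y + b * - a * d by [].
by field; rewrite !gt_eqF.
Qed.

(** Bounding |x + y|^2 with weights b / a and a / b, where a and b bound the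
two norms, makes the sum of the bounds a perfect square. *)
Lemma fnormD f g : fnorm (f + g) <= fnorm f + fnorm g.
Proof.
have key (a b : R) : 0 < a -> 0 < b -> fnorm f <= a -> fnorm g <= b ->
    fnorm (f + g) <= a + b.
  move=> a0 b0 fa gb; apply/fnorm_leP; first by rewrite addr_ge0 ?ltW.
  move=> r ur; have fr := (fnorm_leP f (ltW a0)).1 fa r ur.
  have gr := (fnorm_leP g (ltW b0)).1 gb r ur.
  apply: (@le_trans _ _ (\sum_(s <- r) ((1 + b / a) * hnorm2 (fock_val f s)
      + (1 + a / b) * hnorm2 (fock_val g s)))).
    by apply: ler_sum => s _; exact: hnorm2D_weighted.
  rewrite big_split -!mulr_sumr /=.
  have -> : (a + b) ^+ 2 = (1 + b / a) * a ^+ 2 + (1 + a / b) * b ^+ 2.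
    by field; rewrite !gt_eqF.
  by apply: lerD; rewrite ler_pM2l// addr_gt0// divr_gt0.
apply/ler_addgt0Pr => e e0.
have e2 : 0 < e / 2 by rewrite divr_gt0.
have := key (fnorm f + e / 2) (fnorm g + e / 2).
rewrite !ltr_wpDl ?fnorm_ge0// !lerDl (ltW e2) => /(_ isT isT isT isT).
by rewrite addrACA -splitr.
Qed.

Lemma fnormZ (a : C) f : fnorm (a *: f) = cabs a * fnorm f.
Proof.
have le (b : C) (h : fock X) : fnorm (b *: h) <= cabs b * fnorm h.
  apply: (fnorm_leP (b *: h) (mulr_ge0 (cabs_ge0 b) (fnorm_ge0 h))).2.
  move=> r ur; rewrite exprMn.
  under eq_bigr do rewrite hnorm2Z.
  rewrite -mulr_sumr ler_wpM2l ?sqr_ge0//.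
  exact: (fnorm_leP h (fnorm_ge0 h)).1.
apply/le_anti; rewrite le /=; have [->|a0] := eqVneq a 0.
  by rewrite cabs0 mul0r fnorm_ge0.
rewrite -ler_pdivlMl ?cabs_gt0// -cabsV; apply: (le_trans _ (le a^-1 _)).
by rewrite scalerA mulVf// scale1r.
Qed.

Lemma fnorm0 : fnorm (0 : fock X) = 0.
Proof.
by rewrite -(scale0r (0 : fock X)) fnormZ cabs0 mul0r.
Qed.

Lemma fnormN f : fnorm (- f) = fnorm f.
Proof. by rewrite -scaleN1r fnormZ /cabs normrN1 mul1r. Qed.

Lemma fnorm0_eq0 f : fnorm f <= 0 -> f = 0.
Proof.
move=> f0; apply/val_inj/sectionsP => s /=; apply: hnorm2_eq0.
apply/le_anti; rewrite hnorm2_ge0 andbT.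
apply: (le_trans (hnorm2_le_fnorm f s)).
by rewrite (@le_anti _ _ (fnorm f) 0) ?expr0n// f0 fnorm_ge0.
Qed.

End FockNorm.

(** * Completeness *)

Section Complete.
Variable R : realType.
Local Notation C := R[i].

Definition vanishing (eps : nat -> R) :=
  forall e : R, 0 < e -> exists n0, forall n, (n0 <= n)%N -> eps n <= e.

(** The supremum of the lower bounds x n - eps n lies below all the upper
bounds x m + eps m. *)
Lemma real_cauchy (x eps : nat -> R) :
  (forall n m, (n <= m)%N -> `|x m - x n| <= eps n) ->
  exists l, forall n, `|l - x n| <= eps n.
Proof.
move=> xe; have lo n m : x n - eps n <= x m + eps m.
  have [nm|/ltnW mn] := leqP n m.
    have := xe _ _ nm; have := xe _ _ (leqnn m); rewrite subrr normr0.
    by rewrite ler_norml => ? /andP[]; lra.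
  have := xe _ _ mn; have := xe _ _ (leqnn n); rewrite subrr normr0.
  by rewrite ler_norml => ? /andP[]; lra.
pose S := range (fun n => x n - eps n).
have S0 : S !=set0 by exists (x 0 - eps 0); exists 0.
have Sub : has_ubound S by exists (x 0 + eps 0) => _ [m _ <-].
exists (sup S) => n.
have h1 : x n - eps n <= sup S by apply: ub_le_sup => //; exists n.
have h2 : sup S <= x n + eps n by apply: ge_sup => // _ [m _ <-].
by rewrite ler_norml; apply/andP; split; lra.
Qed.

Lemma hnorm2_onb (V : hilbert R) (e : (hdim V).-tuple V) (x : V) : is_onb e ->
  hnorm2 x = \sum_i (complex.Re (hdot x (tnth e i)) ^+ 2
                     + complex.Im (hdot x (tnth e i)) ^+ 2).
Proof.
move=> eb; apply/(@complexI R); rewrite -hdotxx (parseval _ _ eb) rmorph_sum.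
by apply: eq_bigr => i _; rewrite -normCK [RHS]add_Re2_Im2.
Qed.

Lemma hilbert_cauchy (V : hilbert R) (x : nat -> V) (eps : nat -> R) :
  (forall n m, (n <= m)%N -> hnorm2 (x m - x n) <= eps n ^+ 2) ->
  (forall n, 0 <= eps n) ->
  exists v, forall n, hnorm2 (v - x n) <= (hdim V).*2%:R * eps n ^+ 2.
Proof.
move=> xe e0; pose e := onb V; have eb : is_onb e := onbP V.
have le1 n m i : (n <= m)%N ->
    complex.Re (hdot (x m - x n) (tnth e i)) ^+ 2 <= eps n ^+ 2 /\
    complex.Im (hdot (x m - x n) (tnth e i)) ^+ 2 <= eps n ^+ 2.
  move=> nm; have := xe _ _ nm; rewrite (hnorm2_onb _ eb) (bigD1 i)//= => h.
  set a := complex.Re _ in h *; set b := complex.Im _ in h *.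
  move: h; set S := (X in _ + X <= _) => h.
  have S0 : 0 <= S by apply: sumr_ge0 => j _; rewrite addr_ge0 ?sqr_ge0.
  have := sqr_ge0 a; have := sqr_ge0 b; lra.
have /choice[re reP] : forall i, exists l, forall n,
    `|l - complex.Re (hdot (x n) (tnth e i))| <= eps n.
  move=> i; apply: real_cauchy => n m nm.
  rewrite -raddfB -linearBl -(@ler_pXn2r _ 2) ?nnegrE ?e0//.
  rewrite real_normK ?num_real//.
  by have [] := le1 _ _ i nm.
have /choice[im imP] : forall i, exists l, forall n,
    `|l - complex.Im (hdot (x n) (tnth e i))| <= eps n.
  move=> i; apply: real_cauchy => n m nm.
  rewrite -raddfB -linearBl -(@ler_pXn2r _ 2) ?nnegrE ?e0//.
  rewrite real_normK ?num_real//.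
  by have [] := le1 _ _ i nm.
exists (\sum_i (re i +i* im i)%C *: tnth e i) => n.
rewrite (hnorm2_onb _ eb) -muln2 natrM -mulrA.
apply: (@le_trans _ _ (\sum_(i < hdim V) 2 * eps n ^+ 2)); last first.
  by rewrite sumr_const card_ord -[X in X <= _]mulr_natl.
apply: ler_sum => i _; rewrite linearBl /= linear_sumlz (bigD1 i)//=.
rewrite big1 => [|j ji]; last first.
  by rewrite linearZl_LR /= onb_dot// (negPf ji) mulr0.
rewrite linearZl_LR /= onb_dot// eqxx mulr1 addr0 !raddfB/= mulr_natl mulr2n.
have sq (y : R) : `|y| <= eps n -> y ^+ 2 <= eps n ^+ 2.
  by move=> ye; rewrite -[y ^+ 2]real_normK ?num_real// lerXn2r ?nnegrE.
by apply: lerD; apply: sq.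
Qed.

(** Coordinatewise limits control finitely many coordinates only up to a
constant; letting the second index go to infinity inside a finite sum absorbs
that constant, at the price of a factor 2. *)
Lemma fock_cauchy (X : subproduct_system R) (F : nat -> fock X)
    (eps : nat -> R) : vanishing eps ->
  (forall n m, (n <= m)%N -> fnorm (F m - F n) <= eps n) ->
  exists f, forall n, fnorm (f - F n) <= 2 * eps n.
Proof.
move=> eps_van Fe; have e0 n : 0 <= eps n.
  by apply: (le_trans _ (Fe n n (leqnn n))); exact: fnorm_ge0.
have Fs s n m : (n <= m)%N ->
    hnorm2 (fock_val (F m) s - fock_val (F n) s) <= eps n ^+ 2.
  move=> nm; apply: (le_trans (hnorm2_le_fnorm (F m - F n) s)).
  by rewrite lerXn2r ?nnegrE ?Fe// fnorm_ge0.
have exg : forall s, exists v : X s, forall n,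
    hnorm2 (v - fock_val (F n) s) <= (hdim (X s)).*2%:R * eps n ^+ 2.
  move=> s; apply: (hilbert_cauchy (x := fun n => fock_val (F n) s)) => //.
  exact: Fs.
pose g : sections X := fun s => sval (cid (exg s)).
have gP s n : hnorm2 (g s - fock_val (F n) s) <=
    (hdim (X s)).*2%:R * eps n ^+ 2 by exact: svalP (cid (exg s)) n.
have bound n r : uniq r ->
    \sum_(s <- r) hnorm2 (g s - fock_val (F n) s) <= (2 * eps n) ^+ 2.
  move=> ur; pose K := \sum_(s <- r) (hdim (X s)).*2%:R : R.
  have K0 : 0 <= K by apply: sumr_ge0.
  have le_m m : (n <= m)%N -> \sum_(s <- r) hnorm2 (g s - fock_val (F n) s) <=
      2 * (K * eps m ^+ 2 + eps n ^+ 2).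
    move=> nm; apply: (@le_trans _ _ (2 * (\sum_(s <- r)
        hnorm2 (g s - fock_val (F m) s) + \sum_(s <- r)
        hnorm2 (fock_val (F m - F n) s)))).
      rewrite -big_split mulr_sumr; apply: ler_sum => s _ /=.
      have -> : g s - fock_val (F n) s =
          (g s - fock_val (F m) s) + fock_val (F m - F n) s.
        rewrite -[X in _ = _ + X]/(fock_val (F m) s - fock_val (F n) s).
        by rewrite addrA subrK.
      exact: hnorm2D_le.
    rewrite ler_pM2l// lerD//.
      by rewrite mulr_suml; apply: ler_sum => s _; exact: gP.
    exact: (fnorm_leP (F m - F n) (e0 n)).1 (Fe _ _ nm) r ur.
  rewrite exprMn; apply: (@le_trans _ _ (2 * eps n ^+ 2)); last first.
    by rewrite ler_wpM2r ?sqr_ge0// expr2; lra.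
  apply/ler_addgt0Pr => e egt0.
  pose d := Num.min 1 (e / (2 * (K + 1))).
  have d0 : 0 < d by rewrite lt_min ltr01 divr_gt0// mulr_gt0// ltr_wpDl.
  have [n0 n0P] := eps_van _ d0; pose m := maxn n0 n.
  apply: (le_trans (le_m m (leq_maxr _ _))).
  rewrite mulrDr addrC lerD2l.
  have em : eps m <= d by apply: n0P; exact: leq_maxl.
  have em2 : eps m ^+ 2 <= e / (2 * (K + 1)).
    apply: (@le_trans _ _ (eps m * 1)).
      by rewrite expr2 ler_wpM2l// (le_trans em)// ge_min lexx.
    by rewrite mulr1 (le_trans em)// ge_min lexx orbT.
  have := em2; rewrite ler_pdivlMr; last by rewrite mulr_gt0// ltr_wpDl.
  have := sqr_ge0 (eps m); nra.
have gsq : g \in square_summable (X := X).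
  rewrite -(subrK (fock_val (F 0)) g); apply: rpredD; last exact: fockP.
  suff : (l2norm2 (g - fock_val (F 0))%R < +oo)%E by [].
 
  apply: le_lt_trans (ltry ((2 * eps 0) ^+ 2)).
  exact: (esum_leP ((2 * eps 0) ^+ 2) (fun s => hnorm2_ge0 _)).2 (bound 0).
exists (Fock gsq) => n; apply: (fnorm_leP (Fock gsq - F n) _).2 => //.
  by rewrite mulr_ge0.
exact: bound.
Qed.

End Complete.

(** * Bounded operators and the tensor algebra *)

Section Operators.
Variables (R : realType) (X : subproduct_system R).
Local Notation C := R[i].
Local Notation op := (fock X -> fock X).
Local Notation A := (tensor_algebra (X := X)).
Implicit Types (S T : op) (f g : fock X).

Lemma opnorm_ge0 T : 0 <= opnorm T.
Proof.
rewrite /opnorm; set E := [set _ | _].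
have [[x Ex]|E0] := pselect (E !=set0).
  by apply: lb_le_inf; [exists x|move=> y []].
suff -> : E = set0 by rewrite inf0.
by apply/seteqP; split=> // x Ex; apply: E0; exists x.
Qed.

Lemma opnorm_le T M : 0 <= M -> (forall f, fnorm (T f) <= M * fnorm f) ->
  opnorm T <= M.
Proof. by move=> M0 TM; apply: ge_inf => //; exists 0 => y []. Qed.

Lemma fnorm_op T f : bounded_operator T -> fnorm (T f) <= opnorm T * fnorm f.
Proof.
case=> _ [M TM]; have [f0|f0] := leP (fnorm f) 0.
  have f00 : fnorm f = 0 by apply/le_anti; rewrite f0 fnorm_ge0.
  by have := TM f; rewrite f00 !mulr0.
rewrite -ler_pdivrMr//; apply: lb_le_inf.
  exists `|M|; split => // g; apply: (le_trans (TM g)).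
  by rewrite ler_wpM2r ?fnorm_ge0 ?ler_norm.
by move=> K [_ TK]; rewrite ler_pdivrMr.
Qed.

Section Linear.
Variables (T : op) (bT : bounded_operator T).

Lemma opE a f g : T (a *: f + g) = a *: T f + T g.
Proof. by case: bT => + _; exact. Qed.

Lemma opD f g : T (f + g) = T f + T g.
Proof. by rewrite -[f in LHS]scale1r opE scale1r. Qed.

Lemma op0 : T 0 = 0.
Proof. by apply: (addIr (T 0)); rewrite -opD !add0r. Qed.

Lemma opB f g : T (f - g) = T f - T g.
Proof. by rewrite -scaleN1r addrC opE scaleN1r addrC. Qed.

End Linear.

Lemma bounded_op T M : (forall a f g, T (a *: f + g) = a *: T f + T g) ->
  (forall f, fnorm (T f) <= M * fnorm f) -> bounded_operator T.
Proof. by move=> lT TM; split; [move=> a f g; exact: lT|exists M]. Qed.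

Lemma opnorm0_le : opnorm (0 : op) <= 0.
Proof. by apply: opnorm_le => // f; rewrite mul0r [leLHS]fnorm0. Qed.

Let addE S T f : (S + T) f = S f + T f. Proof. by []. Qed.
Let scaleE a T f : (a *: T) f = a *: T f. Proof. by []. Qed.
Let subE S T f : (S - T) f = S f - T f. Proof. by []. Qed.

Lemma bounded0 : bounded_operator (0 : op).
Proof.
apply: (@bounded_op _ 0) => [a f g|f]; first by rewrite /= scaler0 addr0.
by rewrite mul0r fnorm0.
Qed.

Lemma fnormD_op S T f : bounded_operator S -> bounded_operator T ->
  fnorm ((S + T) f) <= (opnorm S + opnorm T) * fnorm f.
Proof.
move=> bS bT; apply: (le_trans (fnormD _ _)).
by rewrite mulrDl lerD// fnorm_op.
Qed.

Lemma boundedD S T :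
  bounded_operator S -> bounded_operator T -> bounded_operator (S + T).
Proof.
move=> bS bT; apply: bounded_op => [a f g|f]; last exact: fnormD_op.
by rewrite !addE (opE bS) (opE bT) scalerDr addrACA.
Qed.

Lemma opnormD S T : bounded_operator S -> bounded_operator T ->
  opnorm (S + T) <= opnorm S + opnorm T.
Proof.
move=> bS bT; apply: opnorm_le => [|f]; last exact: fnormD_op.
by rewrite addr_ge0 ?opnorm_ge0.
Qed.

Lemma fnormZ_op a T f : bounded_operator T ->
  fnorm ((a *: T) f) <= cabs a * opnorm T * fnorm f.
Proof.
move=> bT; rewrite scaleE fnormZ -mulrA.
by rewrite ler_wpM2l ?cabs_ge0 ?fnorm_op.
Qed.

Lemma boundedZ a T : bounded_operator T -> bounded_operator (a *: T).
Proof.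
move=> bT; apply: bounded_op => [b f g|f]; last exact: fnormZ_op.
by rewrite !scaleE (opE bT) scalerDr !scalerA mulrC.
Qed.

Lemma opnormZ a T : bounded_operator T -> opnorm (a *: T) <= cabs a * opnorm T.
Proof.
move=> bT; apply: opnorm_le => [|f]; last exact: fnormZ_op.
exact: mulr_ge0 (cabs_ge0 a) (opnorm_ge0 T).
Qed.

Lemma boundedN T : bounded_operator T -> bounded_operator (- T).
Proof. by rewrite -scaleN1r; exact: boundedZ. Qed.

Lemma opnormN T : bounded_operator T -> opnorm (- T) <= opnorm T.
Proof.
rewrite -scaleN1r => bT; apply: (le_trans (opnormZ _ bT)).
by rewrite /cabs normrN1 mul1r.
Qed.

Lemma boundedB S T :
  bounded_operator S -> bounded_operator T -> bounded_operator (S - T).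
Proof. by move=> bS bT; apply: boundedD => //; exact: boundedN. Qed.

Lemma opnormB S T : bounded_operator S -> bounded_operator T ->
  opnorm (S - T) <= opnorm (T - S).
Proof. by move=> bS bT; rewrite -opprB; apply: opnormN; exact: boundedB. Qed.

Lemma fnorm_comp S T f : bounded_operator S -> bounded_operator T ->
  fnorm (S (T f)) <= opnorm S * opnorm T * fnorm f.
Proof.
move=> bS bT; apply: (le_trans (fnorm_op _ bS)).
by rewrite -mulrA ler_wpM2l ?opnorm_ge0 ?fnorm_op.
Qed.

Lemma bounded_comp S T :
  bounded_operator S -> bounded_operator T -> bounded_operator (S \o T).
Proof.
move=> bS bT; apply: bounded_op => [a f g|f]; last exact: (fnorm_comp f bS bT).
by rewrite /= (opE bT) (opE bS).
Qed.

Lemma opnorm_comp S T : bounded_operator S -> bounded_operator T ->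
  opnorm (S \o T) <= opnorm S * opnorm T.
Proof.
move=> bS bT; apply: opnorm_le => [|f]; last exact: (fnorm_comp f bS bT).
exact: mulr_ge0 (opnorm_ge0 S) (opnorm_ge0 T).
Qed.

Lemma opnorm_eq0 T :
  bounded_operator T -> (forall e : R, 0 < e -> opnorm T <= e) -> T = 0.
Proof.
move=> bT Te; have T0 : opnorm T <= 0.
  by apply/ler_addgt0Pr => e /Te; rewrite add0r.
apply/funext => f; apply: fnorm0_eq0; apply: (le_trans (fnorm_op f bT)).
by rewrite mulr_le0_ge0 ?fnorm_ge0.
Qed.

Lemma fnorm_creation s (eta : X s) f :
  fnorm (creation eta f) <= Num.sqrt (hnorm2 eta) * fnorm f.
Proof.
apply: (fnorm_leP (creation eta f) _).2.
  by rewrite mulr_ge0 ?sqrtr_ge0 ?fnorm_ge0.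
move=> r ur; rewrite exprMn sqr_sqrtr ?hnorm2_ge0//.
pose p (q : nat * nat) := (q.1 - s.1, q.2 - s.2)%N.
pose D q := s + p q == q.
have c0 q : ~~ D q -> creation_sec eta f q = 0.
  move=> Dq; apply: creation_sec0 => t; apply: contra Dq => /eqP <-.
  by rewrite /D /p /= !addKn; case: (t).
rewrite (bigID D) /= [X in _ + X]big1 ?addr0; last first.
  by move=> q /c0 ->; rewrite hnorm20.
apply: (@le_trans _ _ (hnorm2 eta *
    \sum_(t <- [seq p q | q <- r & D q]) hnorm2 (fock_val f t))).
  rewrite big_map big_filter mulr_sumr; apply: ler_sum => q /eqP Dq.
  rewrite -[in leLHS]Dq creation_secE -hnorm2_tens.
  by apply: coisometry_le; exact: sp_coisometry.
rewrite ler_wpM2l ?hnorm2_ge0//.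
apply: (fnorm_leP f (fnorm_ge0 f)).1 => //.
rewrite map_inj_in_uniq ?filter_uniq// => q q'.
rewrite !mem_filter => /andP[/eqP Dq _] /andP[/eqP Dq' _] pq.
by rewrite -Dq -Dq' pq.
Qed.

Lemma creation_linear s (eta : X s) a f g :
  creation eta (a *: f + g) = a *: creation eta f + creation eta g.
Proof.
apply/val_inj/sectionsP => r /=.
rewrite -[RHS]/(a *: creation_sec eta f r + creation_sec eta g r).
have [[u <-]|sr] := pselect (exists u, s + u = r).
  rewrite !creation_secE.
  have -> : (a *: fock_val f + fock_val g) u =
      a *: fock_val f u + fock_val g u by [].
  by rewrite tensDr tensZr linearP.
have nr t : s + t != r by apply/eqP => st; apply: sr; exists t.
by rewrite !creation_sec0// scaler0 addr0.
Qed.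

Lemma bounded_creation s (eta : X s) : bounded_operator (creation eta).
Proof.
by apply: bounded_op; [exact: creation_linear|exact: fnorm_creation].
Qed.

Lemma opnorm_creation s (eta : X s) :
  opnorm (creation eta) <= Num.sqrt (hnorm2 eta).
Proof. by apply: opnorm_le; [exact: sqrtr_ge0|exact: fnorm_creation]. Qed.

Lemma tensor_algebra_min (M : set op) : operator_algebra M -> norm_closed M ->
  (forall s (eta : X s), M (creation eta)) -> A `<=` M.
Proof.
move=> aM cM gM T; apply; split; first by split.
by move=> _ [s [eta ->]].
Qed.

Lemma tensor_algebra_bounded T : A T -> bounded_operator T.
Proof.
apply: (tensor_algebra_min (M := @bounded_operator _ _)).
- split=> //; [exact: bounded0|exact: boundedD| |exact: bounded_comp].
  exact: boundedZ.
- by [].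
- exact: bounded_creation.
Qed.

Lemma tensor_algebra_creation s (eta : X s) : A (creation eta).
Proof. by move=> M [_ gM]; apply: gM; exists s, eta. Qed.

Lemma tensor_algebra0 : A 0.
Proof. by move=> M [[[_ M0 _ _ _] _] _]. Qed.

Lemma tensor_algebraD S T : A S -> A T -> A (S + T).
Proof.
move=> AS AT M MP; have [[[_ _ MD _ _] _] _] := MP.
by apply: MD; [exact: AS|exact: AT].
Qed.

Lemma tensor_algebraZ a T : A T -> A (a *: T).
Proof.
by move=> AT M MP; have [[[_ _ _ MZ _] _] _] := MP; apply: MZ; exact: AT.
Qed.

Lemma tensor_algebraN T : A T -> A (- T).
Proof. by rewrite -scaleN1r; exact: tensor_algebraZ. Qed.

Lemma tensor_algebraB S T : A S -> A T -> A (S - T).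
Proof. by move=> AS AT; exact: tensor_algebraD AS (tensor_algebraN AT). Qed.

Lemma tensor_algebraM S T : A S -> A T -> A (S \o T).
Proof.
move=> AS AT M MP; have [[[_ _ _ _ MM] _] _] := MP.
by apply: MM; [exact: AS|exact: AT].
Qed.

Lemma tensor_algebra_closed : norm_closed A.
Proof.
move=> T bT Te M MP; have [[_ Mc] _] := MP.
apply: Mc => // e /Te[S AS Se]; exists S => //; exact: AS.
Qed.

Lemma tensor_algebra_operator_algebra : operator_algebra A.
Proof.
split; [exact: tensor_algebra_bounded|exact: tensor_algebra0| | |].
- exact: tensor_algebraD.
- exact: tensor_algebraZ.
- exact: tensor_algebraM.
Qed.

Lemma tensor_algebra_sum (I : Type) (r : seq I) (P : pred I) (F : I -> op) :
  (forall i, P i -> A (F i)) -> A (\sum_(i <- r | P i) F i).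
Proof.
move=> AF; elim/big_rec: _ => [|i T Pi AT]; first exact: tensor_algebra0.
exact: tensor_algebraD (AF i Pi) AT.
Qed.

(** The pointwise limit exists by completeness of Fock space; it is linear,
bounded and a norm limit, so closedness keeps it in the algebra. *)
Lemma tensor_algebra_cauchy (F : nat -> op) (eps : nat -> R) :
  vanishing eps -> (forall n, A (F n)) ->
  (forall n m, (n <= m)%N -> opnorm (F m - F n) <= eps n) ->
  exists2 T, A T & forall n, opnorm (T - F n) <= 2 * eps n.
Proof.
move=> ev AF Fe; have bF n := tensor_algebra_bounded (AF n).
have e0 n : 0 <= eps n.
  by apply: (le_trans _ (Fe n n (leqnn n))); exact: opnorm_ge0.
have /choice[T TP] : forall f, exists g, forall n,
    fnorm (g - F n f) <= 2 * (eps n * fnorm f).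
  move=> f; apply: fock_cauchy => [e egt0|n m nm].
    have d0 : 0 < e / (fnorm f + 1).
      by rewrite divr_gt0// ltr_wpDl ?fnorm_ge0.
    have [n0 n0P] := ev _ d0; exists n0 => n /n0P.
    rewrite ler_pdivlMr ?ltr_wpDl ?fnorm_ge0//.
    by have := e0 n; have := fnorm_ge0 f; nra.
  apply: (le_trans (fnorm_op f (boundedB (bF m) (bF n)))).
  by rewrite ler_wpM2r ?fnorm_ge0 ?Fe.
have small (g : fock X) (K : R) :
    0 <= K -> (forall n, fnorm g <= K * eps n) -> g = 0.
  move=> K0 gK; apply: fnorm0_eq0; apply/ler_addgt0Pr => e egt0.
  have [n nP] := ev _ (divr_gt0 egt0 (ltr_wpDl K0 ltr01)).
  rewrite add0r (le_trans (gK n))//; have := nP n (leqnn n).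
  by rewrite ler_pdivlMr ?ltr_wpDl//; have := e0 n; nra.
have lT a f g : T (a *: f + g) = a *: T f + T g.
  apply/eqP; rewrite -subr_eq0; apply/eqP.
  apply: (small _ (2 * fnorm (a *: f + g) + cabs a * (2 * fnorm f) +
                   2 * fnorm g)).
    by rewrite !addr_ge0 ?mulr_ge0 ?fnorm_ge0 ?cabs_ge0.
  move=> n; have -> : T (a *: f + g) - (a *: T f + T g) =
      (T (a *: f + g) - F n (a *: f + g)) +
      ((- a) *: (T f - F n f) - (T g - F n g)).
    rewrite (opE (bF n)) scaleNr scalerBr -opprD (addrACA (a *: T f)).
    by rewrite -opprD opprB subrKA.
  apply: (le_trans (fnormD _ _)).
  apply: (le_trans (lerD (TP _ n) (fnormD _ _))).
  rewrite fnormN fnormZ.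
  have := TP f n; have := TP g n; rewrite /cabs normrN -/(cabs a).
  by have := cabs_ge0 a; nra.
have TFn n f : fnorm ((T - F n) f) <= 2 * eps n * fnorm f.
  by rewrite -mulrA; exact: TP.
have bT : bounded_operator T.
  rewrite -(subrK (F 0) T); apply: boundedD => //.
  apply: bounded_op (TFn 0) => a f g.
  rewrite !subE lT (opE (bF 0)).
  by rewrite scalerBr opprD addrACA.
have TFe n : opnorm (T - F n) <= 2 * eps n.
  by apply: opnorm_le => //; rewrite mulr_ge0.
exists T => //; apply: tensor_algebra_closed => // e egt0.
have [n nP] := ev (e / 4) (divr_gt0 egt0 (ltr0n _ 4)).
exists (F n) => //; apply: (le_lt_trans (TFe n)).
by have := nP n (leqnn n); lra.
Qed.

End Operators.

(** * Automatic continuity *)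

Section Geometric.
Variable R : realType.

(** Bernoulli: r^n (1 + n (1 - r)) is at most 1. *)
Lemma vanishing_geometric (K r : R) : 0 <= K -> 0 <= r -> r < 1 ->
  vanishing (fun n => K * r ^+ n).
Proof.
move=> K0 r0 r1 e e0; have d0 : 0 < 1 - r by rewrite subr_gt0.
have bern n : r ^+ n * (1 + n%:R * (1 - r)) <= 1.
  elim: n => [|n IHn]; first by rewrite mul0r addr0 mulr1.
  apply: le_trans IHn; rewrite exprS -mulrA mulrCA ler_wpM2l ?exprn_ge0//.
  rewrite -natr1 -subr_ge0.
  have -> : 1 + n%:R * (1 - r) - r * (1 + (n%:R + 1) * (1 - r)) =
      (n%:R + 1) * (1 - r) ^+ 2 by ring.
  by rewrite mulr_ge0 ?sqr_ge0// addr_ge0.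
pose n0 := Num.bound (K / (e * (1 - r))).
exists n0 => n n0n; have [Kn|Kn] := leP K (e * (1 + n%:R * (1 - r))).
  apply: (@le_trans _ _ (e * (1 + n%:R * (1 - r)) * r ^+ n)).
    by rewrite ler_wpM2r ?exprn_ge0.
  by rewrite -mulrA [_ * r ^+ n]mulrC; have := bern n; nra.
have K1 : 0 <= K / (e * (1 - r)) by rewrite divr_ge0// mulr_ge0// ltW.
have := archi_boundP K1; rewrite ltr_pdivrMr ?mulr_gt0// -/n0 => Kn0.
have nn : n0%:R <= n%:R :> R by rewrite ler_nat.
exfalso; have : n0%:R * (e * (1 - r)) <= n%:R * (e * (1 - r)).
  by rewrite ler_wpM2r// mulr_ge0// ltW.
lra.
Qed.

End Geometric.

Section Banach.
Variables (R : realType) (X : subproduct_system R).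
Local Notation op := (fock X -> fock X).
Local Notation A := (tensor_algebra (X := X)).
Implicit Types S T U : op.

Lemma opnorm_triangle S T U : A S -> A T -> A U ->
  opnorm (S - U) <= opnorm (S - T) + opnorm (T - U).
Proof.
move=> AS AT AU; rewrite -(subrKA T S (- U)); apply: opnormD;
  by apply: tensor_algebra_bounded; apply: tensor_algebraB.
Qed.

Lemma opnormC S T : A S -> A T -> opnorm (S - T) = opnorm (T - S).
Proof.
move=> AS AT; apply/le_anti.
by rewrite !opnormB//; exact: tensor_algebra_bounded.
Qed.

Lemma comp_opB T (F G : op) : A T -> (T \o F) - (T \o G) = T \o (F - G).
Proof.
move=> /tensor_algebra_bounded bT; apply/funext => f.
exact: esym (opB bT (F f) (G f)).
Qed.

(** If the value of a character at T exceeded the norm of T, then after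
rescaling the Neumann series S of T would satisfy S = T + TS while the
character takes the value 1 at T. *)
Lemma character_le alpha T : is_character alpha -> A T ->
  cabs (alpha T) <= opnorm T.
Proof.
move=> [aD aZ aM _] AT0; rewrite leNgt; apply/negP => lt_aT.
have aT0 : alpha T != 0.
  by rewrite -cabs_gt0; apply: le_lt_trans lt_aT; exact: opnorm_ge0.
pose V := (alpha T)^-1 *: T.
have AV : A V := tensor_algebraZ _ AT0.
have bV := tensor_algebra_bounded AV.
have aV : alpha V = 1 by rewrite aZ// mulVf.
have r0 : 0 <= opnorm V := opnorm_ge0 V.
have r1 : opnorm V < 1.
  apply: le_lt_trans (opnormZ _ (tensor_algebra_bounded AT0)) _.
  by rewrite cabsV mulrC ltr_pdivrMr ?mul1r// cabs_gt0.
set r := opnorm V in r0 r1; pose K := r / (1 - r).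
have K0 : 0 <= K by rewrite divr_ge0// subr_ge0 ltW.
have KE : r + r * K = K by rewrite /K; field; rewrite subr_eq0 gt_eqF.
(* F n is the sum of the powers V, V^2, .., V^n. *)
pose F := fix F n := if n is n'.+1 then V + (V \o F n') else 0 : op.
have FS n : F n.+1 = V + (V \o F n) by [].
have AF n : A (F n).
  elim: n => [|n IHn]; first exact: tensor_algebra0.
  by rewrite FS; exact: tensor_algebraD AV (tensor_algebraM AV IHn).
have bF n := tensor_algebra_bounded (AF n).
have FK n : opnorm (F n) <= K.
  elim: n => [|n IHn]; first exact: le_trans (opnorm0_le X) K0.
  rewrite FS; apply: (le_trans (opnormD bV (bounded_comp bV (bF n)))).
  rewrite -[leRHS]KE lerD2l; apply: (le_trans (opnorm_comp bV (bF n))).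
  by rewrite ler_wpM2l.
have FD n d : opnorm (F (n + d)%N - F n) <= K * r ^+ n.
  elim: n => [|n IHn]; first by rewrite expr0 mulr1 subr0; exact: FK.
  rewrite addSn !FS opprD addrACA subrr add0r comp_opB//.
  apply: (le_trans (opnorm_comp bV (boundedB (bF _) (bF _)))).
  by rewrite exprS mulrCA ler_wpM2l.
have Fe n m : (n <= m)%N -> opnorm (F m - F n) <= K * r ^+ n.
  by move=> nm; rewrite -(subnKC nm); exact: FD.
have [S AS SF] := tensor_algebra_cauchy (vanishing_geometric K0 r0 r1) AF Fe.
have SE : S = V + (V \o S).
  have AVS : A (V \o S) := tensor_algebraM AV AS.
  have AVF n : A (V \o F n) := tensor_algebraM AV (AF n).
  apply/eqP; rewrite -subr_eq0; apply/eqP/opnorm_eq0.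
    exact: tensor_algebra_bounded (tensor_algebraB AS (tensor_algebraD AV AVS)).
  move=> e e0; have K4 : 0 <= 4 * K by rewrite mulr_ge0.
  have [n nP] := vanishing_geometric K4 r0 r1 e0.
  apply: le_trans (nP n (leqnn n)).
  apply: (le_trans (opnorm_triangle AS (AF n.+1) (tensor_algebraD AV AVS))).
  have -> : F n.+1 - (V + (V \o S)) = V \o (F n - S).
    by rewrite FS opprD addrACA subrr add0r comp_opB.
  have bFS : bounded_operator (F n - S).
    exact: tensor_algebra_bounded (tensor_algebraB (AF n) AS).
  have := opnorm_comp bV bFS; rewrite (opnormC (AF n) AS).
  have := SF n; have := SF n.+1; rewrite exprS -/r.
  have rn : 0 <= K * r ^+ n by rewrite mulr_ge0 ?exprn_ge0.
  have rS : 0 <= opnorm (S - F n) := opnorm_ge0 _.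
  nra.
have AVS : A (V \o S) := tensor_algebraM AV AS.
have : alpha (V + (V \o S)) = 1 + alpha S.
  by rewrite (aD _ _ AV AVS) (aM _ _ AV AS) aV mul1r.
by rewrite -SE => /eqP; rewrite eq_sym -subr_eq0 addrK oner_eq0.
Qed.

End Banach.

(** * The open mapping theorem *)

Section OpenMapping.
Variables (R : realType) (X Y : subproduct_system R).
Local Notation C := R[i].
Local Notation opX := (fock X -> fock X).
Local Notation opY := (fock Y -> fock Y).
Local Notation A := (tensor_algebra (X := X)).
Local Notation B := (tensor_algebra (X := Y)).
Variables (phi : opX -> opY) (psi : opY -> opX) (M : R).
Hypothesis phiB : forall S, A S -> B (phi S).
Hypothesis psiA : forall S, B S -> A (psi S).
Hypotheses (phiK : forall S, A S -> psi (phi S) = S).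
Hypotheses (psiK : forall S, B S -> phi (psi S) = S).
Hypothesis phiD : forall S T, A S -> A T -> phi (S + T) = phi S + phi T.
Hypothesis phiZ : forall a S, A S -> phi (a *: S) = a *: phi S.
Hypothesis phiM : forall S, A S -> opnorm (phi S) <= M * opnorm S.

Lemma inverseD S T : B S -> B T -> psi (S + T) = psi S + psi T.
Proof.
move=> BS BT; have AS := psiA BS; have AT := psiA BT.
rewrite -{1}(psiK BS) -{1}(psiK BT) -(phiD AS AT) phiK//.
exact: tensor_algebraD.
Qed.

Lemma inverseZ a S : B S -> psi (a *: S) = a *: psi S.
Proof.
move=> BS; have AS := psiA BS.
by rewrite -{1}(psiK BS) -(phiZ a AS) phiK//; exact: tensor_algebraZ.
Qed.

Lemma inverseB S T : B S -> B T -> psi (S - T) = psi S - psi T.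
Proof.
move=> BS BT; rewrite -(scaleN1r T) (inverseD BS (tensor_algebraZ _ BT)).
by rewrite (inverseZ _ BT) scaleN1r.
Qed.

Local Notation p S := (opnorm (psi S)).

Lemma invnormD S T : B S -> B T -> p (S + T) <= p S + p T.
Proof.
move=> BS BT; rewrite inverseD//.
apply: opnormD; first exact: tensor_algebra_bounded (psiA BS).
exact: tensor_algebra_bounded (psiA BT).
Qed.

Lemma invnormB S T : B S -> B T -> p (S - T) <= p S + p T.
Proof.
move=> BS BT; rewrite inverseB//; have AT := psiA BT; have AS := psiA BS.
have bS := tensor_algebra_bounded AS; have bT := tensor_algebra_bounded AT.
apply: (le_trans (opnormD bS (boundedN bT))).
by rewrite lerD2l; exact: opnormN.
Qed.

Lemma invnormZ (t : R) S : 0 <= t -> B S -> p (t%:C%C *: S) <= t * p S.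
Proof.
move=> t0 BS; rewrite inverseZ//; apply: (le_trans (opnormZ _ _)).
  exact: tensor_algebra_bounded (psiA BS).
by rewrite cabs_real ger0_norm.
Qed.

(** Baire: were every sublevel set of the seminorm p nowhere dense, a sequence
of nested balls, the n-th one away from the n-th sublevel set, would have a
common point at which p has no value. *)
Lemma invnorm_somewhere_dense : exists (n : nat) y0 (r : R),
  [/\ B y0, 0 < r & forall y, B y -> opnorm (y - y0) <= r ->
    forall d : R, 0 < d ->
      exists z, [/\ B z, p z <= n%:R & opnorm (y - z) <= d]].
Proof.
have halve (x y z : R) : z <= x / 2 -> x + (2 * y - 2 * x) <= 2 * y - 2 * z.
  by move=> zx; lra.
apply/not_existsP => nd.
pose good n (u v : opY * R) := (B v.1 /\ 0 < v.2 /\ v.2 <= u.2 / 2 /\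
  opnorm (v.1 - u.1) <= u.2 /\
  forall z, B z -> p z <= n%:R -> 5 * v.2 < opnorm (v.1 - z)).
(* The limit of the centres is within 4 times the radius of each centre, so a
   margin of 5 radii keeps it away from the sublevel set. *)
have /choice[g gP] : forall nu : nat * (opY * R), exists v, B nu.2.1 ->
    0 < nu.2.2 -> good nu.1 nu.2 v.
  move=> [n [y0 r]] /=.
  have [[By r0]|nBr] := pselect (B y0 /\ 0 < r); last first.
    by exists (y0, r) => By r0; case: nBr.
  apply: contrapT => no; apply: (nd n); exists y0, r; split=> // y By' yr d d0.
  apply: contrapT => noz; apply: no.
  exists (y, Num.min (r / 2) (d / 10)) => _ _; split=> //=.
  rewrite lt_min !divr_gt0// ge_min lexx; split=> //; split=> //; split=> //.
  move=> z Bz pz; rewrite ltNge; apply/negP => zd; apply: noz; exists z.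
  split=> //; apply: (le_trans zd).
  have : Num.min (r / 2) (d / 10) <= d / 10 by rewrite ge_min lexx orbT.
  lra.
pose u := fix u n : opY * R := if n is n'.+1 then g (n', u n') else (0, 1).
have u0 : B (u 0%N).1 /\ 0 < (u 0%N).2 by split=> //; exact: tensor_algebra0.
have uS n : B (u n).1 /\ 0 < (u n).2 -> good n (u n) (u n.+1).
  by case=> Bu ru; exact: gP (n, u n) Bu ru.
have uB n : B (u n).1 /\ 0 < (u n).2.
  by elim: n => // n /uS[Bu [ru _]].
have {uS}ug n : good n (u n) (u n.+1) by apply: uS.
have r_le n : (u n).2 <= 1 * 2^-1 ^+ n.
  elim: n => [|n IHn]; first by rewrite mul1r.
  have [_ [_ [h _]]] := ug n; apply: (le_trans h).
  by rewrite exprS mulrCA mulrC ler_pM2l ?invr_gt0.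
have Fe n m : (n <= m)%N ->
    opnorm ((u m).1 - (u n).1) <= 2 * (u n).2 - 2 * (u m).2.
  elim: m => [|m IHm].
    by rewrite leqn0 => /eqP ->; rewrite !subrr; exact: opnorm0_le.
  rewrite leq_eqVlt => /predU1P[->|nm].
    by rewrite !subrr; exact: opnorm0_le.
  have [Bm [_ [h1 [h2 _]]]] := ug m.
  apply: (le_trans (opnorm_triangle Bm (uB m).1 (uB n).1)).
  apply: (le_trans (lerD h2 (IHm nm))).
  exact: halve.
have van : vanishing (fun n => 2 * (u n).2).
  move=> e e0; have [] := @vanishing_geometric _ 2 2^-1 _ _ _ e e0; try lra.
  move=> n0 n0P; exists n0 => n nn; apply: le_trans (n0P n nn).
  by rewrite ler_pM2l//; have := r_le n; rewrite mul1r.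
have [||y By yF] := tensor_algebra_cauchy van (F := fun n => (u n).1).
- by move=> n; have [] := uB n.
- by move=> n m nm; apply: (le_trans (Fe _ _ nm)); have [_] := uB m; lra.
pose n := Num.bound (p y).
have pyn : p y <= n%:R by apply/ltW/archi_boundP/opnorm_ge0.
have [Bu [ru [_ [_ h]]]] := ug n; have := h _ By pyn.
by rewrite opnormC//; have := yF n.+1; lra.
Qed.

(** Differences of two points of the ball on which a sublevel set of p is
dense fill a ball around 0, and scaling reaches every y. *)
Lemma invnorm_approx : exists2 K : R, 0 <= K &
  forall y nu e, B y -> 0 < nu -> opnorm y <= nu -> 0 < e ->
    exists z, [/\ B z, p z <= K * nu & opnorm (y - z) <= e].
Proof.
have [n [y0 [r [By0 r0 H]]]] := invnorm_somewhere_dense.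
exists (2 * n%:R / r); first by rewrite divr_ge0 ?mulr_ge0// ltW.
move=> y nu e By nu0 ynu e0; pose t := r / nu.
have t0 : 0 < t by rewrite divr_gt0.
have Bty : B (t%:C%C *: y) := tensor_algebraZ _ By.
have norm_t S : B S -> opnorm (t%:C%C *: S) <= t * opnorm S.
  move=> /tensor_algebra_bounded bS; apply: (le_trans (opnormZ _ bS)).
  by rewrite cabs_real gtr0_norm.
have te : 0 < t * e / 2 by rewrite divr_gt0// mulr_gt0.
have [||z1 [Bz1 pz1 z1e]] := H (t%:C%C *: y + y0) _ _ _ te.
- exact: tensor_algebraD.
- rewrite addrK; apply: (le_trans (norm_t _ By)).
  by rewrite /t mulrAC ler_pdivrMr// ler_pM2l.
have [|z2 [Bz2 pz2 z2e]] := H y0 By0 _ _ te.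
  by rewrite subrr; exact: le_trans (opnorm0_le Y) (ltW r0).
have Bz := tensor_algebraB Bz1 Bz2.
exists ((t^-1)%:C%C *: (z1 - z2)); split; first exact: tensor_algebraZ.
- have it0 : 0 <= t^-1 by rewrite invr_ge0 ltW.
  apply: (le_trans (invnormZ it0 Bz)).
  have -> : 2 * n%:R / r * nu = t^-1 * (n%:R + n%:R).
    by rewrite /t; field; rewrite !gt_eqF.
  rewrite ler_pM2l ?invr_gt0//; apply: (le_trans (invnormB Bz1 Bz2)).
  exact: lerD.
- have -> : y - (t^-1)%:C%C *: (z1 - z2) =
      (t^-1)%:C%C *: ((t%:C%C *: y + y0 - z1) - (y0 - z2)).
    rewrite [- (y0 - z2)]opprD (addrACA (t%:C%C *: y + y0)) addrK -opprD.
    rewrite [in RHS]scalerBr scalerA -rmorphM /= mulVf ?gt_eqF//.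
    by rewrite rmorph1 scale1r.
  have B1 : B (t%:C%C *: y + y0 - z1).
    exact: tensor_algebraB (tensor_algebraD Bty By0) Bz1.
  have B2 := tensor_algebraB By0 Bz2.
  have b1 := tensor_algebra_bounded B1; have b2 := tensor_algebra_bounded B2.
  apply: (le_trans (opnormZ _ (boundedB b1 b2))).
  rewrite cabs_real gtr0_norm ?invr_gt0// ler_pdivrMl//.
  have := opnormD b1 (boundedN b2); have := opnormN b2; lra.
Qed.

(** Approximating the successive remainders exhausts y by images of a norm
convergent series. *)
Lemma inverse_bounded : exists K : R, forall S, B S -> p S <= K * opnorm S.
Proof.
have [K K0 HK] := invnorm_approx; exists (4 * K) => y By.
suff H nu : 0 < nu -> opnorm y <= nu -> p y <= 4 * K * nu.
  apply/ler_addgt0Pr => e e0.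
  have K1 : 0 < 4 * K + 1 by rewrite ltr_wpDl// mulr_ge0.
  have d0 : 0 < e / (4 * K + 1) by rewrite divr_gt0.
  apply: (le_trans (H (opnorm y + e / (4 * K + 1)) _ _)).
  - by rewrite ltr_wpDl ?opnorm_ge0.
  - by rewrite lerDl ltW.
  - rewrite mulrDr lerD2l mulrA ler_pdivrMr//; nra.
move=> nu0 ynu.
have /choice[h hP] : forall ynu : opY * R, exists z, B ynu.1 -> 0 < ynu.2 ->
    opnorm ynu.1 <= ynu.2 ->
    [/\ B z, p z <= K * ynu.2 & opnorm (ynu.1 - z) <= ynu.2 / 2].
  move=> [w mu] /=; have [[Bw mu0 wmu]|nB] :=
      pselect [/\ B w, 0 < mu & opnorm w <= mu]; last first.
    by exists w => Bw mu0 wmu; case: nB.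
  have [|z zP] := HK w mu (mu / 2) Bw mu0 wmu; first by rewrite divr_gt0.
  by exists z.
pose q n := nu * 2^-1 ^+ n.
have q0 n : 0 < q n by rewrite mulr_gt0// exprn_gt0// invr_gt0.
have qS n : q n.+1 = q n / 2 by rewrite /q exprS; ring.
pose w := fix w n := if n is n'.+1 then w n' - h (w n', q n') else y.
have wB n : B (w n) /\ opnorm (w n) <= q n.
  elim: n => [|n [Bw wq]]; first by rewrite /q expr0 mulr1.
  have [Bz _ zq] := hP (w n, q n) Bw (q0 n) wq.
  by rewrite qS; split=> //; exact: tensor_algebraB.
have zP n := hP (w n, q n) (wB n).1 (q0 n) (wB n).2.
pose F n := psi (y - w n).
have Byw n : B (y - w n) := tensor_algebraB By (wB n).1.
have Fe n m : (n <= m)%N -> opnorm (F m - F n) <= 2 * K * q n.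
  move=> nm; suff : opnorm (F m - F n) <= 2 * K * (q n - q m).
    by have := q0 m; have := q0 n; nra.
  rewrite /F -inverseB// opprB addrC subrKA.
  have p0 : opnorm (psi 0) <= 0.
    rewrite -(scale0r 0) (inverseZ _ (@tensor_algebra0 _ Y)) scale0r.
    exact: opnorm0_le.
  elim: m nm => [|m IHm].
    by rewrite leqn0 => /eqP ->; rewrite !subrr mulr0.
  rewrite leq_eqVlt => /predU1P[->|nm]; first by rewrite !subrr mulr0.
  have [Bz pz _] := zP m; have [Bm _] := wB m; have [Bn _] := wB n.
  rewrite [w m.+1]/(w m - h (w m, q m)) opprB addrA addrAC.
  apply: (le_trans (invnormD (tensor_algebraB Bn Bm) Bz)).
  apply: (le_trans (lerD (IHm nm) pz)).
  by rewrite /= qS; have := q0 m; lra.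
have van : vanishing (fun n => 2 * K * q n).
  move=> e e0; have [] := @vanishing_geometric _ (2 * K * nu) 2^-1 _ _ _ e e0.
  - by rewrite !mulr_ge0// ltW.
  - by rewrite invr_ge0.
  - lra.
  - by move=> n0 n0P; exists n0 => n /n0P; rewrite /q mulrA.
have AF n : A (F n) by apply: psiA.
have [x Ax xF] := tensor_algebra_cauchy van AF Fe.
have xy : phi x = y.
  have Bx := phiB Ax; apply/eqP; rewrite -subr_eq0; apply/eqP/opnorm_eq0.
    exact: tensor_algebra_bounded (tensor_algebraB Bx By).
  move=> e e0; have c0 : 0 <= (`|M| * (4 * K) + 1) * nu.
    by rewrite mulr_ge0 ?(ltW nu0)// addr_ge0// !mulr_ge0.
  have h1 : (2^-1 : R) < 1 by lra.
  have h0 : (0 : R) <= 2^-1 by lra.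
  have [n nP] := vanishing_geometric c0 h0 h1 e0.
  apply: le_trans (nP n (leqnn n)); rewrite -mulrA -/(q n).
  have Axn := tensor_algebraB Ax (AF n).
  have phixn : phi (x - F n) = phi x - (y - w n).
    rewrite -scaleN1r (phiD Ax (tensor_algebraZ _ (AF n))) (phiZ _ (AF n)).
    by rewrite scaleN1r /F psiK.
  have -> : phi x - y = phi (x - F n) - w n.
    by rewrite phixn -addrA -opprD subrK.
  have [Bw wq] := wB n.
  apply: (le_trans (opnormD (tensor_algebra_bounded (phiB Axn))
    (boundedN (tensor_algebra_bounded Bw)))).
  have := opnormN (tensor_algebra_bounded Bw); have := phiM Axn.
  have h3 : M * opnorm (x - F n) <= `|M| * (4 * K * q n).
    apply: (@le_trans _ _ (`|M| * opnorm (x - F n))).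
      by rewrite ler_wpM2r ?opnorm_ge0 ?ler_norm.
    by rewrite ler_wpM2l//; have := xF n; lra.
  rewrite mulrDl mul1r -mulrA; lra.
have := xF 0%N; rewrite -xy phiK// /F /w subrr /q expr0.
have -> : psi 0 = 0.
  by rewrite -(scale0r 0) (inverseZ _ (@tensor_algebra0 _ Y)) scale0r.
by rewrite subr0; lra.
Qed.

End OpenMapping.

Theorem bounded_isomorphism_inverse (R : realType) (X Y : subproduct_system R)
    (phi : (fock X -> fock X) -> (fock Y -> fock Y)) :
  bounded_isomorphism phi ->
  exists psi : (fock Y -> fock Y) -> (fock X -> fock X),
    bounded_isomorphism psi.
Proof.
case=> [[phiB phi_inj phi_surj] phiD phiZ phiMul [M phiM]].
have /choice[psi psiP] : forall S, exists T, tensor_algebra (X := Y) S ->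
    tensor_algebra T /\ phi T = S.
  move=> S; have [BS|nBS] := pselect (tensor_algebra S); last by exists 0.
  by have [T AT <-] := phi_surj _ BS; exists T.
have psiA S : tensor_algebra S -> tensor_algebra (psi S) by case/psiP.
have psiK S : tensor_algebra S -> phi (psi S) = S by case/psiP.
have phiK S : tensor_algebra S -> psi (phi S) = S.
  move=> AS; have BS := phiB _ AS.
  by apply: phi_inj; rewrite ?inE//; [exact: psiA|exact: psiK].
exists psi; split.
- split=> [S BS|S T|T AT]; first exact: psiA.
    by rewrite !inE => BS BT e; rewrite -(psiK S)// e psiK.
  by exists (phi T); [exact: phiB|exact: phiK].
- move=> S T; exact: (inverseD psiA phiK psiK phiD).
- move=> a S; exact: (inverseZ psiA phiK psiK phiZ).
- move=> S T BS BT; have AS := psiA _ BS; have AT := psiA _ BT.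
  rewrite -{1}(psiK _ BS) -{1}(psiK _ BT) -phiMul// phiK//.
  exact: tensor_algebraM.
- exact: (inverse_bounded phiB psiA phiK psiK phiD phiZ phiM).
Qed.

(** * Polynomials modulo a power of the maximal ideal *)

Section Truncation.
Variables (N : nat) (F : fieldType).
Local Notation poly := (mpoly N F).
Implicit Types (p q r : poly) (K : nat).

(** Congruence modulo the K-th power of the ideal of the origin. *)
Definition eqmod K p q :=
  forall a : multinom N, (mdeg a < K)%N -> mcoeff a p = mcoeff a q.

Lemma eqmod_refl K p : eqmod K p p.
Proof. by []. Qed.

Lemma eqmod_sym K p q : eqmod K p q -> eqmod K q p.
Proof. by move=> pq a aK; rewrite pq. Qed.

Lemma eqmod_trans K q p r : eqmod K p q -> eqmod K q r -> eqmod K p r.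
Proof. by move=> pq qr a aK; rewrite pq// qr. Qed.

Lemma eqmodW K L p q : (L <= K)%N -> eqmod K p q -> eqmod L p q.
Proof. by move=> LK pq a aL; apply: pq; apply: leq_trans LK. Qed.

Lemma eqmodD K p p' q q' :
  eqmod K p p' -> eqmod K q q' -> eqmod K (p + q) (p' + q').
Proof. by move=> pp qq a aK; rewrite !mcoeffD pp// qq. Qed.

Lemma eqmodZ K c p p' : eqmod K p p' -> eqmod K (c *: p) (c *: p').
Proof. by move=> pp a aK; rewrite !mcoeffZ pp. Qed.

Lemma eqmodD0 K p q : eqmod K p 0 -> eqmod K q 0 -> eqmod K (p + q) 0.
Proof. by move=> p0 q0; rewrite -(addr0 0); exact: eqmodD. Qed.

Lemma eqmod_sub0 K p q : eqmod K p q -> eqmod K (p - q) 0.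
Proof. by move=> pq a aK; rewrite mcoeffB pq// subrr mcoeff0. Qed.

Lemma eqmod_sum K (I : Type) (s : seq I) (P : pred I) (f g : I -> poly) :
  (forall i, P i -> eqmod K (f i) (g i)) ->
  eqmod K (\sum_(i <- s | P i) f i) (\sum_(i <- s | P i) g i).
Proof.
move=> fg; elim/big_rec2: _ => [|i p q Pi pq]; first exact: eqmod_refl.
exact: eqmodD (fg i Pi) pq.
Qed.

Lemma eqmodM K p p' q q' :
  eqmod K p p' -> eqmod K q q' -> eqmod K (p * q) (p' * q').
Proof.
move=> pp qq a aK; rewrite !mcoeffM; apply: eq_bigr => k /eqP ak.
have := congr1 (@mdeg N) ak; rewrite mdegD => da.
have k1 := leq_trans (leq_addr _ _) (eq_leq (esym da)).
have k2 := leq_trans (leq_addl _ _) (eq_leq (esym da)).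
by rewrite pp ?qq// (leq_ltn_trans _ aK).
Qed.

Lemma eqmodM0 K p q : eqmod K q 0 -> eqmod K (p * q) 0.
Proof. by move=> q0; rewrite -(mulr0 p); exact: eqmodM (eqmod_refl p) q0. Qed.

Lemma eqmod_mul0 i j p q :
  eqmod i p 0 -> eqmod j q 0 -> eqmod (i + j) (p * q) 0.
Proof.
move=> pi qj a aij; rewrite mcoeffM mcoeff0 big1// => k /eqP ak.
have [ki|ik] := ltnP (mdeg (bmnm k.1)) i; first by rewrite pi// mcoeff0 mul0r.
have := congr1 (@mdeg N) ak; rewrite mdegD => da.
rewrite qj ?mcoeff0 ?mulr0// -(ltn_add2l i) (leq_ltn_trans _ aij)//.
by apply: leq_trans (eq_leq (esym da)); rewrite leq_add2r.
Qed.

Lemma eqmod_mderiv K i p q :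
  eqmod K.+1 p q -> eqmod K (mderiv i p) (mderiv i q).
Proof.
by move=> pq a aK; rewrite !mcoeff_mderiv pq// mdegD mdeg1 addn1 ltnS.
Qed.

Lemma eqmod_var i : eqmod 1 (mpolyX F (mnm1 i)) 0.
Proof.
move=> a; rewrite ltnS leqn0 mdeg_eq0 => /eqP ->.
by rewrite mcoeffX mcoeff0 -mdeg_eq0 mdeg1.
Qed.

Lemma eqmod_prod0 (I : Type) (s : seq I) (g : I -> poly) :
  (forall i, eqmod 1 (g i) 0) -> eqmod (size s) (\prod_(i <- s) g i) 0.
Proof.
move=> g0; elim: s => [|i s IHs] //.
by rewrite big_cons; exact: (eqmod_mul0 (g0 i) IHs).
Qed.

(** Multiplication by a variable raises the degree by one: the lowest term of
the image is zero and the highest term of the source is lost modulo m^K. *)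
Lemma eqmod_shift_sum K (f g : nat -> poly) :
  eqmod K (f 0%N) 0 -> (forall i, eqmod K (f i.+1) (g i)) ->
  (forall i, (K <= i.+1)%N -> eqmod K (g i) 0) ->
  eqmod K (\sum_(i < K) f i) (\sum_(i < K) g i).
Proof.
case: K => [|K] f0 fg gK //; rewrite big_ord_recl big_ord_recr.
rewrite [X in eqmod _ X]addrC; apply: eqmodD; last first.
  by apply: eqmod_trans f0 _; apply: eqmod_sym; exact: gK.
by apply: eqmod_sum => i _; exact: fg.
Qed.

(** If B = I modulo m, then B r = 0 determines r from (I - B) r, whose order of
vanishing exceeds that of r by one. *)
Lemma eqmod_unipotent n (B : 'I_n -> 'I_n -> poly) (r : 'I_n -> poly) K :
  (forall i j, mcoeff mnm0 (B i j) = (i == j)%:R) ->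
  (forall j, eqmod K (\sum_i B i j * r i) 0) -> forall i, eqmod K (r i) 0.
Proof.
move=> B1 Br; suff H d : (d <= K)%N -> forall i, eqmod d (r i) 0 by exact: H.
elim: d => // d IHd dK j a ad.
have := Br j a (leq_trans ad dK).
have -> : \sum_i B i j * r i = r j + \sum_i (B i j - (i == j)%:R) * r i.
  under [in RHS]eq_bigr do rewrite mulrBl.
  rewrite sumrB; have -> : \sum_i (i == j)%:R * r i = r j.
    rewrite (bigD1 j)//= eqxx mul1r big1 ?addr0// => i ij.
    by rewrite (negPf ij) mul0r.
  by rewrite addrC subrK.
rewrite mcoeffD raddf_sum /= big1 ?addr0// => i _.
have B0 : eqmod 1 (B i j - (i == j)%:R) 0.
  move=> b; rewrite ltnS leqn0 mdeg_eq0 => /eqP ->.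
  rewrite mcoeffB B1 mcoeff0; case: eqP => _; rewrite ?mcoeff1 ?eqxx ?subrr//.
  by rewrite mcoeff0 subrr.
by rewrite (eqmod_mul0 B0 (IHd (ltnW dK) i) ad) mcoeff0.
Qed.

End Truncation.

(** * Substitution *)

Section Substitution.
Variables (N M : nat) (F : fieldType) (G : 'I_N -> mpoly M F).
Implicit Types p q : mpoly N F.

Definition subst p : mpoly M F := mmap (@mpolyC M F) G p.

HB.instance Definition _ := GRing.RMorphism.copy subst (mmap (@mpolyC M F) G).

Lemma substX i : subst (mpolyX F (mnm1 i)) = G i.
Proof. by rewrite /subst mmapX mmap1U. Qed.

Lemma substC c : subst (mpolyC N c) = mpolyC M c.
Proof. by rewrite /subst mmapC. Qed.

Lemma substZ c p : subst (c *: p) = c *: subst p.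
Proof. by rewrite /subst mmapZ mul_mpolyC. Qed.

Lemma subst0 : subst 0 = 0. Proof. exact: rmorph0. Qed.

Lemma substD p q : subst (p + q) = subst p + subst q.
Proof. exact: rmorphD. Qed.

Lemma substB p q : subst (p - q) = subst p - subst q.
Proof. exact: rmorphB. Qed.

Lemma substM p q : subst (p * q) = subst p * subst q.
Proof. exact: rmorphM. Qed.

Lemma subst_sum (I : Type) (r : seq I) (P : pred I) (f : I -> mpoly N F) :
  subst (\sum_(i <- r | P i) f i) = \sum_(i <- r | P i) subst (f i).
Proof. exact: rmorph_sum. Qed.

Lemma subst_prod (I : Type) (r : seq I) (P : pred I) (f : I -> mpoly N F) :
  subst (\prod_(i <- r | P i) f i) = \prod_(i <- r | P i) subst (f i).
Proof. exact: rmorph_prod. Qed.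

Lemma mcoeff0_meval (q : mpoly M F) : mcoeff mnm0 q = meval (fun=> 0) q.
Proof.
elim/mpolyind: q => [|c a q _ _ IHq]; first by rewrite mcoeff0 meval0.
rewrite mcoeffD mevalD IHq mcoeffZ mevalZ mcoeffX mevalX; congr (_ * _ + _).
have [->|] := eqVneq a mnm0.
  by rewrite big1// => i _; rewrite mnm0E expr0.
rewrite -mdeg_eq0 mdegE -lt0n lt0n sum_nat_eq0 negb_forall.
case/existsP => i; rewrite implyTb => ai.
by rewrite (bigD1 i)//= expr0n (negPf ai) mul0r.
Qed.

Lemma mcoeff0_subst p :
  mcoeff mnm0 (subst p) = meval (fun i => mcoeff mnm0 (G i)) p.
Proof.
rewrite mcoeff0_meval /subst /mmap raddf_sum mevalE; apply: eq_bigr => a _ /=.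
rewrite mevalM mevalC; congr (_ * _); rewrite /mmap1 rmorph_prod.
by apply: eq_bigr => i _; rewrite rmorphXn /= mcoeff0_meval.
Qed.

Lemma chain_rule p l : mderiv l (subst p) =
  \sum_i subst (mderiv i p) * mderiv l (G i).
Proof.
pose chain q := mderiv l (subst q) =
  \sum_i subst (mderiv i q) * mderiv l (G i).
have chainM q r : chain q -> chain r -> chain (q * r).
  rewrite /chain => cq cr; rewrite substM mderivM cq cr mulr_suml mulr_sumr.
  rewrite -big_split; apply: eq_bigr => i _ /=.
  rewrite mderivM substD !substM mulrDl; congr (_ + _).
    by rewrite -!mulrA; congr (_ * _); rewrite mulrC.
  by rewrite mulrA.
have chain1 : chain 1.
  rewrite /chain -mpolyC1 substC mderivC big1// => i _.
  by rewrite mderivC rmorph0 mul0r.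
have chainX i : chain (mpolyX F (mnm1 i)).
  rewrite /chain substX (bigD1 i)//= mderivX mnm1E eqxx scale1r.
  rewrite big1 => [|j ji].
    rewrite addr0 (_ : mnm_sub _ _ = mnm0) ?mpolyX0 ?rmorph1 ?mul1r//.
    by rewrite -{1}(add0m (mnm1 i)) addmK.
  by rewrite mderivX mnm1E eq_sym (negPf ji) scale0r rmorph0 mul0r.
elim/mpolyind: p => [|c a p _ _ IHp].
  by rewrite rmorph0 mderiv0 big1// => i _; rewrite mderiv0 rmorph0 mul0r.
have cX : chain (mpolyX F a).
  rewrite mpolyXE_id; apply: (big_ind chain) => // i _.
  by elim: (a i) => [|k IHk]; rewrite ?expr0// exprS; apply: chainM.
rewrite rmorphD /= mderivD IHp substZ mderivZ cX scaler_sumr -big_split /=.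
apply: eq_bigr => i _.
by rewrite mderivD mderivZ rmorphD /= substZ mulrDl scalerAl.
Qed.

(** Differentiating p(G) = 0 mod m^(K+1) gives a linear system for the values
(d_i p)(G) mod m^K whose matrix, the Jacobian of G, is invertible. *)
Lemma eqmod_subst_mderiv (E : 'I_M -> 'I_N -> F) K p :
  (forall i j, \sum_l mcoeff (mnm1 l) (G i) * E l j = (i == j)%:R) ->
  eqmod K.+1 (subst p) 0 -> forall i, eqmod K (subst (mderiv i p)) 0.
Proof.
move=> GE p0; apply: (@eqmod_unipotent _ _ _
  (fun i j => \sum_l E l j *: mderiv l (G i))) => [i j|j].
  rewrite raddf_sum -GE /=; apply: eq_bigr => l _.
  by rewrite mcoeffZ mcoeff_mderiv mnm0E mulr1n add0m mulrC.
have -> : \sum_i (\sum_l E l j *: mderiv l (G i)) * subst (mderiv i p) =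
    \sum_l E l j *: mderiv l (subst p).
  under eq_bigr do rewrite mulr_suml.
  rewrite exchange_big /=; apply: eq_bigr => l _.
  rewrite chain_rule scaler_sumr; apply: eq_bigr => i _.
  by rewrite -scalerAl mulrC.
suff : eqmod K (\sum_l E l j *: mderiv l (subst p)) (\sum_(l < M) 0).
  by rewrite sumr_const mul0rn.
apply: eqmod_sum => l _; rewrite -(scaler0 _ (E l j)); apply: eqmodZ.
by rewrite -(mderiv0 F l); apply: eqmod_mderiv.
Qed.

(** Each derivative costs one order, so fewer than K of them leave a
congruence modulo m, whose constant term is the value at the point G(0). *)
Lemma mderivm_vanish (E : 'I_M -> 'I_N -> F) K p (a : multinom N) :
  (forall i j, \sum_l mcoeff (mnm1 l) (G i) * E l j = (i == j)%:R) ->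
  eqmod K (subst p) 0 -> (mdeg a < K)%N ->
  meval (fun i => mcoeff mnm0 (G i)) (mderivm a p) = 0.
Proof.
move=> GE; elim: K a p => // K IHK a p pK aK.
have [->|] := eqVneq a mnm0.
  by rewrite mderivm0m -mcoeff0_subst pK ?mdeg0// mcoeff0.
rewrite -mdeg_eq0 mdegE sum_nat_eq0 negb_forall.
case/existsP => i; rewrite implyTb => ai.
have aE : a = mnm_add (mnm1 i) (mnm_sub a (mnm1 i)).
  rewrite addmC submK//; apply/mnm_lepP => j; rewrite mnm1E.
  by case: eqP => // <-; rewrite lt0n.
rewrite aE mderivmDm mderivmU1m; apply: IHK.
  exact: eqmod_subst_mderiv GE pK i.
by move: aK; rewrite {1}aE mdegD mdeg1 ltnS.
Qed.

End Substitution.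

(** * Words in the creation operators *)

Section CreationAlgebra.
Variables (R : realType) (X : subproduct_system R).
Local Notation C := R[i].
Local Notation op := (fock X -> fock X).
Local Notation A := (tensor_algebra (X := X)).

Lemma section_cast (g : sections X) q r (e : q = r) :
  ecast r (X r) e (g q) = g r.
Proof. by case: r / e. Qed.

Lemma inc_cast q r (e : q = r) (x : X q) : inc (ecast r (X r) e x) = inc x.
Proof. by case: r / e. Qed.

Lemma inc_in s (x : X s) : fock_val (inc x) s = x.
Proof. exact: dfwith_in. Qed.

Lemma inc_injective s : injective (@inc R X s).
Proof. by move=> x y xy; rewrite -(inc_in x) xy inc_in. Qed.

Lemma tens0r (V W : hilbert R) (x : V) : tens x (0 : W) = 0.
Proof. by rewrite -(scale0r (0 : W)) tensZr scale0r. Qed.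

Lemma inc_linear s a (x y : X s) : inc (a *: x + y) = a *: inc x + inc y.
Proof.
apply/val_inj/sectionsP => r /=.
rewrite -[RHS]/(a *: inc_sec x r + inc_sec y r).
have [->|rs] := eqVneq r s; first by rewrite /inc_sec !dfwith_in.
by rewrite /inc_sec !dfwith_out 1?eq_sym// scaler0 addr0.
Qed.

Lemma creation_lin s a (x y : X s) :
  creation (a *: x + y) = a *: creation x + creation y.
Proof.
apply/funext => f; apply/val_inj/sectionsP => r /=.
rewrite -[RHS]/(a *: creation_sec x f r + creation_sec y f r).
have [[u <-]|sr] := pselect (exists u, s + u = r).
  by rewrite !creation_secE tensDl tensZl linearP.
have nr t : s + t != r by apply/eqP => st; apply: sr; exists t.
by rewrite !creation_sec0// scaler0 addr0.
Qed.

Lemma creation0 s : creation (0 : X s) = 0.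
Proof.
have := creation_lin (-1) (0 : X s) 0; rewrite scaleN1r oppr0 add0r => h.
by rewrite h scaleN1r addNr.
Qed.

Lemma creation_sum s (I : Type) (r : seq I) (P : pred I) (c : I -> C)
    (x : I -> X s) :
  creation (\sum_(i <- r | P i) c i *: x i) =
  \sum_(i <- r | P i) c i *: creation (x i).
Proof.
elim/big_rec2: _ => [|i T y _ <-]; first exact: creation0.
exact: creation_lin.
Qed.

Lemma creation_mul s t (eta : X s) (zeta : X t) :
  creation (sp_mul X s t (tens eta zeta)) = creation eta \o creation zeta.
Proof.
apply/funext => f; apply/val_inj/sectionsP => r /=.
have [[w <-]|nr] := pselect (exists w, (s + t) + w = r).
  rewrite creation_secE -sp_mulA.
  by rewrite -[RHS](section_cast _ (addrA s t w)) !creation_secE.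
rewrite creation_sec0 => [|w]; last by apply/eqP => e; apply: nr; exists w.
have [[v sv]|nv] := pselect (exists v, s + v = r); last first.
  by rewrite creation_sec0// => v; apply/eqP => e; apply: nv; exists v.
rewrite -sv creation_secE /= creation_sec0 ?tens0r ?linear0// => w.
by apply/eqP => tw; apply: nr; exists w; rewrite -addrA tw.
Qed.

Lemma creation_one : creation (sp_one X) = id.
Proof.
apply/funext => f; apply/val_inj/sectionsP => r /=.
rewrite -[LHS](section_cast _ (add0r r)) creation_secE.
exact: sp_mul1l.
Qed.

Lemma tensor_algebra_id : A id.
Proof. by rewrite -creation_one; exact: tensor_algebra_creation. Qed.

Lemma character_id alpha : is_character (X := X) alpha -> alpha id = 1.
Proof.
move=> [_ _ aM [T AT aT]]; apply: (mulfI aT).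
by rewrite mulr1 -(aM _ _ AT tensor_algebra_id).
Qed.

Definition vacuum : fock X := inc (sp_one X).

Lemma creation_vacuum s (eta : X s) : creation eta vacuum = inc eta.
Proof. by rewrite creation_inc -(inc_cast (addr0 s)) sp_mul1r. Qed.

Lemma inc0 s : inc (0 : X s) = 0.
Proof. by rewrite -creation_vacuum creation0. Qed.

Lemma sp_mul_surj s t (y : X (s + t)) : exists x, y = sp_mul X s t x.
Proof.
have [U _ /lfunP/(_ y)] := sp_coisometry X s t.
by rewrite comp_lfunE id_lfunE => yE; exists (U y).
Qed.

Section Span.
Variable P : op -> Prop.
Hypotheses (P0 : P 0) (Plin : forall a S T, P S -> P T -> P (a *: S + T)).

Lemma span_sum (I : Type) (r : seq I) (Q : pred I) (c : I -> C) (T : I -> op) :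
  (forall i, P (T i)) -> P (\sum_(i <- r | Q i) c i *: T i).
Proof. by move=> PT; elim/big_rec: _ => // i S _; exact: Plin. Qed.

Lemma creation_span_step s t (d : (hdim (X s)).-tuple (X s)) : is_onb d ->
  (forall k (y : X t), P (creation (tnth d k) \o creation y)) ->
  forall y : X (s + t), P (creation y).
Proof.
move=> ond Pd y; have [x ->] := sp_mul_surj y.
rewrite (tens_span x) linear_sum /=.
under eq_bigr do rewrite linear_sum /=.
rewrite (eq_bigr (fun i => 1 *: \sum_j x i j *: sp_mul X s t
   (tens (tnth (onb (X s)) i) (tnth (onb (X t)) j)))); last first.
  by move=> i _; rewrite scale1r; apply: eq_bigr => j _; rewrite linearZ.
rewrite creation_sum; apply: span_sum => i.
rewrite creation_sum; apply: span_sum => j.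
rewrite creation_mul (onb_sum (tnth (onb (X s)) i) ond) creation_sum.
set z := tnth (onb (X t)) j.
rewrite (_ : _ \o _ = \sum_k hdot (tnth (onb (X s)) i) (tnth d k) *:
   (creation (tnth d k) \o creation z)); first exact: span_sum.
apply/funext => f; rewrite /= !fct_sumE.
by [].
Qed.

End Span.

Section Words.
Variable e : (sp_m X).-tuple (X (1%N, 0%N)).
Variable f : (sp_n X).-tuple (X (0%N, 1%N)).
Local Notation Z k := (creation (tnth e k)).
Local Notation W l := (creation (tnth f l)).

(** Operators on Fock space rather than vectors of X(i, j): composition is
strictly associative, so no transport along equalities of degrees is needed. *)
Definition word (s : seq 'I_(sp_m X)) (t : seq 'I_(sp_n X)) : op :=
  foldr (fun k T => Z k \o T) (foldr (fun l T => W l \o T) id t) s.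

Lemma creation_prod_F t :
  creation (prod_F (size t) [seq tnth f l | l <- t]) = word [::] t.
Proof.
elim: t => [|l t IHt]; first exact: creation_one.
apply: etrans (@creation_mul _ (0%N, size t) (tnth f l) (prod_F _ _)) _.
by rewrite IHt.
Qed.

Lemma creation_sp_M i j s t : size s = i -> size t = j ->
  creation (sp_M i j [seq tnth e k | k <- s] [seq tnth f l | l <- t]) =
  word s t.
Proof.
move=> <- <-; rewrite /sp_M creation_mul creation_prod_F.
elim: s => [|k s IHs]; first by rewrite [creation _]creation_one.
transitivity (Z k \o word s t) => //; rewrite -IHs.
have := @creation_mul _ (size s, 0%N) (tnth e k)
  (prod_E (size s) [seq tnth e k | k <- s]).
by move=> h; rewrite compA -h.
Qed.

Lemma tensor_algebra_word s t : A (word s t).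
Proof.
by rewrite -(creation_sp_M erefl erefl); exact: tensor_algebra_creation.
Qed.

Lemma word_vacuum i j s t : size s = i -> size t = j ->
  word s t vacuum =
  inc (sp_M i j [seq tnth e k | k <- s] [seq tnth f l | l <- t]).
Proof. by move=> si tj; rewrite -(creation_sp_M si tj) creation_vacuum. Qed.

Hypotheses (ebase : is_onb e) (fbase : is_onb f).

(** Coisometries are onto, so every homogeneous element is a combination of
products of degree one elements. *)
Lemma creation_span i j (P : op -> Prop) : P 0 ->
  (forall a S T, P S -> P T -> P (a *: S + T)) ->
  (forall s t, size s = i -> size t = j -> P (word s t)) ->
  forall y : X (i, j), P (creation y).
Proof.
elim: i P => [|i IHi] P P0 Plin Pw.
  elim: j P P0 Plin Pw => [|j IHj] P P0 Plin Pw y.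
    have yE : exists c, y = c *: sp_one X.
      have one0 : sp_one X != 0.
        apply/eqP => e0; have := sp_one1 X; rewrite e0 linear0l => /eqP.
        by rewrite eq_sym oner_eq0.
      have : y \in <[sp_one X]>%VS.
        suff -> : <[sp_one X]>%VS = {:X 0%R}%VS by exact: memvf.
        apply/eqP; rewrite eqEdim subvf dim_vline one0.
        by have := sp_dim0 X; rewrite /hdim => ->.
      by case/vlineP => c ->; exists c.
    have [c ->] := yE.
    have -> : creation (c *: sp_one X) = c *: word [::] [::] + 0.
      rewrite (_ : word _ _ = id)// -creation_one -(creation0 0%R).
      by rewrite -(@creation_lin 0%R) addr0.
    by apply: Plin => //; exact: Pw.
  apply: (@creation_span_step P P0 Plin _ (0%N, j) f fbase) => l.
  apply: (IHj (fun T => P (W l \o T))) => [|a S T PS PT|[|//] t _ tj].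
  - have -> : W l \o (0 : op) = 0.
      by apply/funext => g; exact: (op0 (bounded_creation _)).
    exact: P0.
  - have -> : W l \o (a *: S + T) = a *: (W l \o S) + (W l \o T).
      by apply/funext => g; exact: creation_linear.
    exact: Plin.
  - by apply: (Pw [::] (l :: t)) => //=; rewrite tj.
apply: (@creation_span_step P P0 Plin _ (i, j) e ebase) => k.
apply: (IHi (fun T => P (Z k \o T))) => [|a S T PS PT|s t si tj].
- have -> : Z k \o (0 : op) = 0.
    by apply/funext => g; exact: (op0 (bounded_creation _)).
  exact: P0.
- have -> : Z k \o (a *: S + T) = a *: (Z k \o S) + (Z k \o T).
    by apply/funext => g; exact: creation_linear.
  exact: Plin.
- by apply: (Pw (k :: s) t) => //=; rewrite si.
Qed.

(** By creation_span the creation operators of degree one, together with the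
unit, generate a dense subalgebra. *)
Lemma tensor_algebra_ind (P : set op) : operator_algebra P -> norm_closed P ->
  P id -> (forall k, P (Z k)) -> (forall l, P (W l)) -> A `<=` P.
Proof.
move=> Palg Pc Pid PZ PW; have [_ P0 PD Psc PM] := Palg.
apply: tensor_algebra_min => // -[i j]; apply: creation_span => //.
  by move=> a S T PS PT; apply: PD => //; exact: Psc.
move=> s t _ _; elim: s => [|k s IHs]; last exact: PM (PZ k) IHs.
by elim: t => [|l t IHt]; last exact: PM (PW l) IHt.
Qed.

End Words.

End CreationAlgebra.

(** * The relations that define the ideal *)

Section Relations.
Variables (R : realType) (X : subproduct_system R).
Local Notation C := R[i].
Local Notation op := (fock X -> fock X).
Local Notation A := (tensor_algebra (X := X)).
Local Notation m := (sp_m X).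
Local Notation n := (sp_n X).

Lemma tens_onb (V W : hilbert R) (e : (hdim V).-tuple V)
    (f : (hdim W).-tuple W) (x : tensor V W) : is_onb e -> is_onb f ->
  x = \sum_k \sum_l hdot x (tens (tnth e k) (tnth f l)) *:
        tens (tnth e k) (tnth f l).
Proof.
move=> eb fb; pose Q (x : tensor V W) := x = \sum_k \sum_l
  hdot x (tens (tnth e k) (tnth f l)) *: tens (tnth e k) (tnth f l).
have Qlin a y z : Q y -> Q z -> Q (a *: y + z).
  rewrite /Q => yE zE; rewrite {1}yE {1}zE scaler_sumr -big_split /=.
  apply: eq_bigr => k _; rewrite scaler_sumr -big_split /=.
  by apply: eq_bigr => l _; rewrite scalerA -scalerDl linearDl /= linearZl_LR.
have Qsum (I : finType) (c : I -> C) (y : I -> tensor V W) :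
    (forall i, Q (y i)) -> Q (\sum_i c i *: y i).
  move=> Qy; elim/big_rec: _ => [|i z _ Qz]; last exact: Qlin.
  by rewrite /Q big1// => k _; rewrite big1// => l _; rewrite linear0l scale0r.
have Qtens v w : Q (tens v w).
  rewrite /Q {1}(onb_sum v eb) {1}(onb_sum w fb).
  have tl (y : W) (c : 'I_(hdim V) -> C) :
      tens (\sum_k c k *: tnth e k) y = \sum_k c k *: tens (tnth e k) y.
    elim/big_rec2: _ => [|k z t _ <-]; last by rewrite tensDl tensZl.
    by rewrite -(scale0r (0 : V)) tensZl scale0r.
  have tr (y : V) (c : 'I_(hdim W) -> C) :
      tens y (\sum_l c l *: tnth f l) = \sum_l c l *: tens y (tnth f l).
    elim/big_rec2: _ => [|k z t _ <-]; last by rewrite tensDr tensZr.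
    exact: tens0r.
  rewrite tl; apply: eq_bigr => k _; rewrite tr scaler_sumr.
  by apply: eq_bigr => l _; rewrite scalerA hdot_tens.
rewrite -/(Q x) (tens_span x).
rewrite (eq_bigr (fun i => 1 *: \sum_j x i j *:
  tens (tnth (onb V) i) (tnth (onb W) j))) => [|i _]; last by rewrite scale1r.
by apply: (Qsum) => i; apply: Qsum.
Qed.

Section Generators.
Variables (e : m.-tuple (X (1%N, 0%N))) (f : n.-tuple (X (0%N, 1%N))).

(** The shape of char_point, for functions on operators with values in any
type. *)
Definition generator_values (T : Type) (F : op -> T) (k : 'I_(m + n)) : T :=
  match fintype.split k with
  | inl i => F (creation (tnth e i))
  | inr j => F (creation (tnth f j))
  end.

Lemma generator_values_l (T : Type) (F : op -> T) i :
  generator_values F (lshift n i) = F (creation (tnth e i)).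
Proof.
by rewrite /generator_values -[lshift n i]/(unsplit (inl i)) unsplitK.
Qed.

Lemma generator_values_r (T : Type) (F : op -> T) j :
  generator_values F (rshift m j) = F (creation (tnth f j)).
Proof.
by rewrite /generator_values -[rshift m j]/(unsplit (inr j)) unsplitK.
Qed.

End Generators.

Variable B : frame X.
Local Notation e := (frame_e B).
Local Notation f := (frame_f B).
Local Notation Z k := (creation (tnth e k)).
Local Notation W l := (creation (tnth f l)).

Lemma creation_commutation i j : W j \o Z i =
  \sum_k \sum_l u_coef B k l i j *: (Z k \o W l).
Proof.
have [_ uc] := frame_uP B.
rewrite -creation_mul.
have -> : creation (sp_mul X (0%N, 1%N) (1%N, 0%N) (tens (tnth f j) (tnth e i)))
  = creation (sp_mul X (1%N, 0%N) (0%N, 1%N)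
      (frame_u B (tens (tnth f j) (tnth e i)))) by rewrite uc.
rewrite (tens_onb (frame_u B _) (frame_eP B) (frame_fP B)) linear_sum /=.
rewrite (eq_bigr (fun k => 1 *: \sum_l u_coef B k l i j *:
  sp_mul X (1%N, 0%N) (0%N, 1%N) (tens (tnth e k) (tnth f l)))); last first.
  move=> k _; rewrite scale1r linear_sum; apply: eq_bigr => l _.
  by rewrite linearZ.
rewrite creation_sum; apply: eq_bigr => k _; rewrite scale1r creation_sum.
by apply: eq_bigr => l _; rewrite creation_mul.
Qed.

Section Evaluation.
Variables (M K : nat) (Psi : op -> mpoly M C).
Hypotheses (PsiD : forall S T, A S -> A T -> Psi (S + T) = Psi S + Psi T)
  (PsiZ : forall a S, A S -> Psi (a *: S) = a *: Psi S)
  (Psi1 : eqmod K (Psi id) 1)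
  (PsiM : forall S T, A S -> A T -> eqmod K (Psi (S \o T)) (Psi S * Psi T)).

Local Notation G := (generator_values e f Psi).

Lemma eval0 : Psi 0 = 0.
Proof.
by rewrite -(scale0r (0 : op)) PsiZ ?scale0r//; exact: tensor_algebra0.
Qed.

Lemma eval_sum (I : finType) (c : I -> C) (T : I -> op) :
  (forall i, A (T i)) -> Psi (\sum_i c i *: T i) = \sum_i c i *: Psi (T i).
Proof.
move=> AT; suff [] : A (\sum_i c i *: T i) /\
    Psi (\sum_i c i *: T i) = \sum_i c i *: Psi (T i) by [].
elim/big_rec2: _ => [|i p S _ [AS <-]].
  by split; [exact: tensor_algebra0|exact: eval0].
have ATi := tensor_algebraZ (c i) (AT i).
by split; [exact: tensor_algebraD|rewrite PsiD ?PsiZ].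
Qed.

Lemma eval_sum2 (I J : finType) (c : I -> J -> C) (T : I -> J -> op) :
  (forall i j, A (T i j)) -> Psi (\sum_i \sum_j c i j *: T i j) =
  \sum_i \sum_j c i j *: Psi (T i j).
Proof.
move=> AT.
rewrite (eq_bigr (fun i => 1 *: \sum_j c i j *: T i j)) => [|i _]; last first.
  by rewrite scale1r.
rewrite eval_sum => [|i].
  by apply: eq_bigr => i _; rewrite scale1r eval_sum.
by apply: tensor_algebra_sum => j _; exact: tensor_algebraZ.
Qed.

Lemma eval_word s t : eqmod K (Psi (word e f s t))
  (\prod_(k <- s) Psi (Z k) * \prod_(l <- t) Psi (W l)).
Proof.
elim: s => [|k s IHs]; last first.
  rewrite big_cons -mulrA; apply: eqmod_trans (eqmodM (eqmod_refl _) IHs).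
  apply: PsiM; first exact: tensor_algebra_creation.
  exact: tensor_algebra_word.
rewrite big_nil mul1r; elim: t => [|l t IHt]; first by rewrite big_nil.
rewrite big_cons; apply: eqmod_trans (eqmodM (eqmod_refl _) IHt).
apply: PsiM; first exact: tensor_algebra_creation.
exact: (tensor_algebra_word e f [::]).
Qed.

(** The operators of degree one satisfy all the relations generating J_X, and
so do their images under a homomorphism to a commutative ring. *)
Lemma J_ideal_vanish p : J_ideal B p -> eqmod K (subst G p) 0.
Proof.
have AZ k : A (Z k) := tensor_algebra_creation _.
have AW l : A (W l) := tensor_algebra_creation _.
have sz k : subst G (zvar k) = Psi (Z k) by rewrite substX generator_values_l.
have sw l : subst G (wvar l) = Psi (W l) by rewrite substX generator_values_r.
pose I : set (mpoly (m + n) C) := [set q | eqmod K (subst G q) 0].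
move=> Jp; apply: (Jp I); split; last first.
- move=> q [[i [j ->]]|[i [j [a [aker ->]]]]]; rewrite /I /=.
  + have h : eqmod K (Psi (W j \o Z i))
        (subst G (wvar j * zvar i : mpoly (m + n) C)).
      by rewrite substM sz sw; exact: PsiM.
    rewrite /commutation_poly substB; apply: eqmod_sub0.
    apply: eqmod_trans (eqmod_sym h) _.
    rewrite creation_commutation eval_sum2 => [|k l]; last first.
      exact: tensor_algebraM.
    rewrite subst_sum; apply: eqmod_sum => k _.
    rewrite subst_sum; apply: eqmod_sum => l _.
    by rewrite substZ substM sz sw; apply/eqmodZ/PsiM.
  + have w0 : \sum_s \sum_t a s t *: word e f s t = 0.
      have wE (s : i.-tuple 'I_m) (t : j.-tuple 'I_n) : word e f s t =
          creation (sp_M i j [seq tnth e k | k <- s] [seq tnth f l | l <- t]).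
        by rewrite (creation_sp_M _ _ (size_tuple s) (size_tuple t)).
      apply: etrans _ (creation0 _ ((i, 0%N) + (0%N, j))%R); rewrite -aker.
      rewrite [in RHS](eq_bigr (fun s => 1 *: \sum_t a s t *:
        sp_M i j [seq tnth e k | k <- s] [seq tnth f l | l <- t])); last first.
        by move=> s _; rewrite scale1r.
      rewrite creation_sum; apply: eq_bigr => s _.
      rewrite scale1r creation_sum; apply: eq_bigr => t _.
      by rewrite wE.
    have := eval0; rewrite -w0 eval_sum2 => [<-|s t]; last first.
      exact: tensor_algebra_word.
    rewrite /q_poly subst_sum; apply: eqmod_sum => s _.
    rewrite subst_sum; apply: eqmod_sum => t _.
    rewrite substZ substM !subst_prod; apply/eqmodZ/eqmod_sym.
    under eq_bigr do rewrite sz; under [X in _ * X]eq_bigr do rewrite sw.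
    exact: eval_word.
- split=> [|q r Iq Ir|q r Ir]; rewrite /I /mkset.
  + by rewrite subst0; exact: eqmod_refl.
  + by rewrite substD; exact: eqmodD0 Iq Ir.
  + by rewrite substM; exact: eqmodM0 Ir.
Qed.

End Evaluation.

End Relations.

(** * Jets at the vacuum *)

Section LinearExtension.
Variable R : realType.
Local Notation C := R[i].

(** A linear map is determined by the images of a spanning family, and exists
as soon as these satisfy the relations of the family. *)
Lemma linear_extension (V : hilbert R) (T : finType) (m : T -> V)
    (Q : lmodType C) (q : T -> Q) :
  (forall y, exists a : T -> C, y = \sum_x a x *: m x) ->
  (forall a : T -> C, \sum_x a x *: m x = 0 -> \sum_x a x *: q x = 0) ->
  exists pi : V -> Q, (forall a x y, pi (a *: x + y) = a *: pi x + pi y) /\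
    forall x, pi (m x) = q x.
Proof.
move=> span rel; have /choice[c cP] := span.
have rel2 (a b : T -> C) : \sum_x a x *: m x = \sum_x b x *: m x ->
    \sum_x a x *: q x = \sum_x b x *: q x.
  move=> ab; apply/eqP; rewrite -subr_eq0 -sumrB.
  under eq_bigr do rewrite -scalerBl.
  rewrite rel//; under eq_bigr do rewrite scalerBl.
  by rewrite sumrB ab subrr.
exists (fun y => \sum_x c y x *: q x); split => [a x y|x].
  rewrite scaler_sumr -big_split /=.
  rewrite [RHS](eq_bigr (fun z => (a * c x z + c y z) *: q z)); last first.
    by move=> z _; rewrite scalerDl scalerA.
  apply: rel2; rewrite -cP {1}(cP x) {1}(cP y) scaler_sumr -big_split /=.
  by apply: eq_bigr => z _; rewrite scalerDl scalerA.
have xE (W : lmodType C) (g : T -> W) : g x = \sum_z (z == x)%:R *: g z.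
  rewrite (bigD1 x)//= eqxx scale1r big1 ?addr0// => z zx.
  by rewrite (negPf zx) scale0r.
by rewrite [RHS]xE; apply: rel2; rewrite -cP -xE.
Qed.

Lemma linear_functional_bounded (V : hilbert R) (h : V -> C) :
  (forall a x y, h (a *: x + y) = a * h x + h y) ->
  exists2 K : R, 0 <= K & forall y b, 0 <= b -> hnorm2 y <= b ^+ 2 ->
    cabs (h y) <= K * b.
Proof.
move=> hlin; pose e := onb V; have eb : is_onb e := onbP V.
have h0 : h 0 = 0.
  by have := hlin (-1) 0 0; rewrite scaler0 add0r mulN1r addNr.
exists (\sum_i cabs (h (tnth e i))).
  by apply: sumr_ge0 => i _; exact: cabs_ge0.
move=> y b b0 yb; rewrite {1}(onb_sum y eb).
have -> : h (\sum_i hdot y (tnth e i) *: tnth e i) =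
    \sum_i hdot y (tnth e i) * h (tnth e i).
  by elim/big_rec2: _ => // i z x _ <-; exact: hlin.
apply: (le_trans (cabs_sum _ _ _)); rewrite mulr_suml; apply: ler_sum => i _.
rewrite cabsM mulrC; apply: ler_wpM2l; first exact: cabs_ge0.
rewrite -(@ler_pXn2r _ 2) ?nnegrE ?cabs_ge0//; apply: le_trans yb.
rewrite (hnorm2_onb y eb) (bigD1 i)//=.
set S := (X in _ <= _ + X); set z := hdot y _.
have S0 : 0 <= S by apply: sumr_ge0 => j _; rewrite addr_ge0 ?sqr_ge0.
suff -> : cabs z ^+ 2 = complex.Re z ^+ 2 + complex.Im z ^+ 2 by rewrite lerDl.
by apply/(@complexI R); rewrite add_Re2_Im2 rmorphXn /= cabsE.
Qed.

End LinearExtension.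

Lemma sum_ord_first (V : nmodType) K (f : nat -> V) : (0 < K)%N ->
  (forall i, (0 < i)%N -> f i = 0) -> \sum_(i < K) f i = f 0%N.
Proof.
by case: K => // K _ f0; rewrite big_ord_recl big1 ?addr0// => i _; exact: f0.
Qed.

Section Jet.
Variables (R : realType) (X : subproduct_system R).
Local Notation C := R[i].
Local Notation op := (fock X -> fock X).
Local Notation A := (tensor_algebra (X := X)).
Local Notation m := (sp_m X).
Local Notation n := (sp_n X).
Local Notation poly := (mpoly (m + n) C).
Variables (e : m.-tuple (X (1%N, 0%N))) (f : n.-tuple (X (0%N, 1%N))).
Hypotheses (ebase : is_onb e) (fbase : is_onb f).
Local Notation Z k := (creation (tnth e k)).
Local Notation W l := (creation (tnth f l)).
Local Notation word := (word e f).
Local Notation vac := (vacuum X).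

Definition monomial (s : seq 'I_m) (t : seq 'I_n) : poly :=
  \prod_(k <- s) zvar k * \prod_(l <- t) wvar l.

(** What the relations of degree less than K must satisfy for polynomials
modulo the K-th power of the maximal ideal to be a quotient of the algebra. *)
Definition relations_vanish K :=
  (forall i j (a : i.-tuple 'I_m -> j.-tuple 'I_n -> C), (i + j < K)%N ->
    \sum_s \sum_t a s t *: word s t vac = 0 -> q_poly a = 0) /\
  ((2 < K)%N -> forall i j, exists c : 'I_m -> 'I_n -> C,
    W j \o Z i = \sum_k \sum_l c k l *: (Z k \o W l) /\
    wvar j * zvar i = \sum_k \sum_l c k l *: (zvar k * wvar l)).

Variable K : nat.
Hypothesis relK : relations_vanish K.

Lemma word_vacuumE i j s t : size s = i -> size t = j ->
  word s t vac = inc (fock_val (word s t vac) (i, j)).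
Proof.
move=> si tj; have wE := word_vacuum e f si tj.
have e1 : ((i, 0%N) + (0%N, j) = (i, j))%R by congr pair; exact: addn0.
rewrite {1}wE -(inc_cast e1); congr (inc _).
by rewrite wE -(section_cast _ e1) inc_in.
Qed.

(** Words of bidegree (i, j) span X(i, j) since coisometries are onto, and
their linear relations are the kernel of M_(i,j), which relations_vanish
sends to 0. *)
Lemma jet_at_exists i j : exists pi : X (i, j) -> poly,
  [/\ forall a x y, pi (a *: x + y) = a *: pi x + pi y,
      (i + j < K)%N -> forall s t, size s = i -> size t = j ->
        pi (fock_val (word s t vac) (i, j)) = monomial s t &
      (K <= i + j)%N -> forall y, pi y = 0].
Proof.
have [ijK|Kij] := ltnP (i + j) K; last first.
  exists (fun=> 0); split=> // [a x y]; by rewrite scaler0 addr0.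
pose T := (i.-tuple 'I_m * j.-tuple 'I_n)%type.
pose w (x : T) : X (i, j) := fock_val (word x.1 x.2 vac) (i, j).
have wE (x : T) : word x.1 x.2 vac = inc (w x).
  by apply: word_vacuumE; rewrite size_tuple.
have [y|a aw|pi [pilin piw]] := @linear_extension R (X (i, j)) T w poly
    (fun x : T => monomial x.1 x.2).
- pose P (S : op) := exists a : T -> C,
    fock_val (S vac) (i, j) = \sum_x a x *: w x.
  suff [a ya] : P (creation y).
    by exists a; rewrite -ya creation_vacuum inc_in.
  apply: (creation_span ebase fbase) y => [|a S S' [b bE] [b' bE']|s t si tj].
  + by exists (fun=> 0); rewrite big1// => x _; rewrite scale0r.
  + exists (fun x => a * b x + b' x).
    rewrite -[LHS]/(a *: fock_val (S vac) (i, j) + fock_val (S' vac) (i, j)).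
    rewrite bE bE' scaler_sumr -big_split /=.
    by apply: eq_bigr => x _; rewrite scalerDl scalerA.
  + have si' : size s == i by apply/eqP.
    have tj' : size t == j by apply/eqP.
    exists (fun x => (x == (Tuple si', Tuple tj'))%:R).
    rewrite (bigD1 (Tuple si', Tuple tj'))//= eqxx scale1r big1 ?addr0//.
    by move=> x /negPf ->; rewrite scale0r.
- have -> : \sum_x a x *: monomial x.1 x.2 =
      \sum_s \sum_t a (s, t) *: monomial s t.
    by rewrite pair_bigA; apply: eq_bigr => -[].
  apply: (relK.1 i j (fun s t => a (s, t)) ijK).
  rewrite pair_bigA; apply: etrans _ (inc0 X (i, j)); rewrite -aw.
  have incsum (b : T -> C) : inc (\sum_x b x *: w x) = \sum_x b x *: inc (w x).
    elim/big_rec2: _ => [|x z y _ <-]; first exact: inc0.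
    exact: inc_linear.
  by rewrite incsum; apply: eq_bigr => -[s t] _; rewrite -wE.
- exists pi; split=> // _ s t si tj.
  have si' : size s == i by apply/eqP.
  have tj' : size t == j by apply/eqP.
  exact: (piw (Tuple si', Tuple tj')).
Qed.

Definition jet_at i j (xi : fock X) : poly :=
  sval (cid (jet_at_exists i j)) (fock_val xi (i, j)).

Lemma jet_at_lin i j a x y :
  jet_at i j (a *: x + y) = a *: jet_at i j x + jet_at i j y.
Proof.
by rewrite /jet_at; case: (cid _) => pi [/= pilin _ _]; exact: pilin.
Qed.

Lemma jet_at_word s t : (size s + size t < K)%N ->
  jet_at (size s) (size t) (word s t vac) = monomial s t.
Proof. by rewrite /jet_at; case: (cid _) => pi [/= _ + _] st; exact. Qed.

Lemma jet_at_high i j xi : (K <= i + j)%N -> jet_at i j xi = 0.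
Proof.
by rewrite /jet_at; case: (cid _) => pi [/= _ _ pi0] Kij; exact: pi0.
Qed.

Lemma jet_at_eq i j xi zeta :
  fock_val xi (i, j) = fock_val zeta (i, j) -> jet_at i j xi = jet_at i j zeta.
Proof. by rewrite /jet_at => ->. Qed.

Lemma jet_at_inc i j xi : jet_at i j xi = jet_at i j (inc (fock_val xi (i, j))).
Proof. by apply: jet_at_eq; rewrite inc_in. Qed.

Lemma jet_at0 i j : jet_at i j 0 = 0.
Proof.
have := jet_at_lin i j (-1) 0 0.
by rewrite scaleN1r oppr0 add0r scaleN1r addNr.
Qed.

Lemma jet_at_sum i j (I : finType) (c : I -> C) (xi : I -> fock X) :
  jet_at i j (\sum_x c x *: xi x) = \sum_x c x *: jet_at i j (xi x).
Proof.
by elim/big_rec2: _ => [|x p z _ <-]; [exact: jet_at0|exact: jet_at_lin].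
Qed.

Lemma word_ind i j (P : fock X -> Prop) :
  P 0 -> (forall a x y, P x -> P y -> P (a *: x + y)) ->
  (forall s t, size s = i -> size t = j -> P (word s t vac)) ->
  forall y : X (i, j), P (inc y).
Proof.
move=> P0 Plin Pw y; rewrite -creation_vacuum.
apply: (creation_span ebase fbase (P := fun S => P (S vac))) y => //.
by move=> a S T; exact: Plin.
Qed.

Lemma monomial_low s t : eqmod (size s + size t) (monomial s t) 0.
Proof. by apply: eqmod_mul0; apply: eqmod_prod0 => i; exact: eqmod_var. Qed.

Lemma jet_at_low i j xi : eqmod (i + j) (jet_at i j xi) 0.
Proof.
have [ijK|Kij] := ltnP (i + j) K; last first.
  by rewrite jet_at_high//; exact: eqmod_refl.
rewrite jet_at_inc.
apply: (word_ind (P := fun x => eqmod (i + j) (jet_at i j x) 0)).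
- by rewrite jet_at0; exact: eqmod_refl.
- move=> a x y x0 y0; rewrite jet_at_lin; apply: eqmodD0 y0.
  by rewrite -(scaler0 _ a); exact: eqmodZ x0.
- move=> s t si tj; rewrite -si -tj in ijK *.
  by rewrite jet_at_word//; exact: monomial_low.
Qed.

Lemma jet_at_Z i j k xi : ((i + j).+1 < K)%N -> 
  jet_at i.+1 j (Z k xi) = zvar k * jet_at i j xi.
Proof.
move=> ijK; have bZ := bounded_creation (tnth e k).
have -> : jet_at i.+1 j (Z k xi) =
    jet_at i.+1 j (Z k (inc (fock_val xi (i, j)))).
  apply: jet_at_eq.
  have h g := @creation_secE _ X (1%N, 0%N) (tnth e k) g (i, j).
  by rewrite [LHS]h [RHS]h inc_in.
rewrite [in RHS]jet_at_inc.
apply: (word_ind (P := fun x => jet_at i.+1 j (Z k x) = zvar k * jet_at i j x)).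
- by rewrite (op0 bZ) !jet_at0 mulr0.
- move=> a x y IHx IHy.
  by rewrite (opE bZ) !jet_at_lin IHx IHy mulrDr scalerAr.
- move=> s t si tj; rewrite -si -tj in ijK *.
  rewrite (jet_at_word (ltnW ijK)) -[Z k (word s t vac)]/(word (k :: s) t vac).
  by rewrite (@jet_at_word (k :: s) t ijK) /monomial big_cons mulrA.
Qed.

(** The operator W_l is moved to the right past the leading Z_k by the
commutation relation; the total degree is then at least 2, whence the guard
in relations_vanish. *)
Lemma jet_at_W_word l s t : ((size s + size t).+1 < K)%N ->
  jet_at (size s) (size t).+1 (W l (word s t vac)) = wvar l * monomial s t.
Proof.
elim: s l => [|k s IHs] l stK.
  rewrite -[W l (word [::] t vac)]/(word [::] (l :: t) vac).
  rewrite (@jet_at_word [::] (l :: t) stK) /monomial !big_nil !mul1r.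
  by rewrite big_cons.
have K2 : (2 < K)%N by apply: leq_ltn_trans stK.
have [c [cop cpol]] := relK.2 K2 k l.
set x := word s t vac.
have -> : W l (word (k :: s) t vac) =
    \sum_k' 1 *: \sum_l' c k' l' *: Z k' (W l' x).
  rewrite -[LHS]/((W l \o Z k) x) cop fct_sumE; apply: eq_bigr => k' _.
  by rewrite scale1r fct_sumE.
rewrite jet_at_sum.
have -> : wvar l * monomial (k :: s) t =
    (\sum_k' \sum_l' c k' l' *: (zvar k' * wvar l')) * monomial s t.
  by rewrite -cpol /monomial big_cons !mulrA.
rewrite mulr_suml; apply: eq_bigr => k' _; rewrite scale1r jet_at_sum mulr_suml.
apply: eq_bigr => l' _; rewrite -scalerAl; congr (_ *: _).
rewrite jet_at_Z; first by rewrite IHs ?mulrA// (ltn_trans _ stK).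
by rewrite addnS.
Qed.

Lemma jet_at_W i j l xi : ((i + j).+1 < K)%N ->
  jet_at i j.+1 (W l xi) = wvar l * jet_at i j xi.
Proof.
move=> ijK; have bW := bounded_creation (tnth f l).
have -> : jet_at i j.+1 (W l xi) =
    jet_at i j.+1 (W l (inc (fock_val xi (i, j)))).
  apply: jet_at_eq.
  have h g := @creation_secE _ X (0%N, 1%N) (tnth f l) g (i, j).
  by rewrite [LHS]h [RHS]h inc_in.
rewrite [in RHS]jet_at_inc.
apply: (word_ind (P := fun x => jet_at i j.+1 (W l x) = wvar l * jet_at i j x)).
- by rewrite (op0 bW) !jet_at0 mulr0.
- move=> a x y IHx IHy.
  by rewrite (opE bW) !jet_at_lin IHx IHy mulrDr scalerAr.
- move=> s t si tj; rewrite -si -tj in ijK *.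
  by rewrite jet_at_W_word// (jet_at_word (ltnW ijK)).
Qed.

Definition jet xi : poly := \sum_(i < K) \sum_(j < K) jet_at i j xi.

Lemma jet_lin a x y : jet (a *: x + y) = a *: jet x + jet y.
Proof.
rewrite /jet scaler_sumr -big_split; apply: eq_bigr => i _.
by rewrite scaler_sumr -big_split; apply: eq_bigr => j _; exact: jet_at_lin.
Qed.

Lemma jet_at_top i j xi (p : poly) : (K <= (i + j).+1)%N -> eqmod 1 p 0 ->
  eqmod K (p * jet_at i j xi) 0.
Proof.
move=> Kij p0; exact: eqmodW Kij (eqmod_mul0 p0 (@jet_at_low i j xi)).
Qed.

Lemma jet_at_creation0 s (eta : X s) i j xi :
  (forall t, s + t != (i, j)) -> jet_at i j (creation eta xi) = 0.
Proof.
move=> st; rewrite -(jet_at0 i j); apply: jet_at_eq.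
exact: creation_sec0.
Qed.

Lemma jet_Z k xi : eqmod K (jet (Z k xi)) (zvar k * jet xi).
Proof.
rewrite /jet exchange_big [X in zvar k * X]exchange_big mulr_sumr.
apply: eqmod_sum => j _; rewrite mulr_sumr.
apply: (@eqmod_shift_sum _ _ K (fun i => jet_at i j (Z k xi))
                               (fun i => zvar k * jet_at i j xi)) => [|i|i iK].
- by rewrite jet_at_creation0; [exact: eqmod_refl|case].
- have [ijK|Kij] := ltnP (i + j).+1 K.
    by rewrite jet_at_Z//; exact: eqmod_refl.
  by rewrite jet_at_high//; apply/eqmod_sym/jet_at_top => //; exact: eqmod_var.
- apply: jet_at_top; last exact: eqmod_var.
  by apply: leq_trans iK _; rewrite ltnS leq_addr.
Qed.

Lemma jet_W l xi : eqmod K (jet (W l xi)) (wvar l * jet xi).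
Proof.
rewrite /jet mulr_sumr; apply: eqmod_sum => i _; rewrite mulr_sumr.
apply: (@eqmod_shift_sum _ _ K (fun j => jet_at i j (W l xi))
                               (fun j => wvar l * jet_at i j xi)) => [|j|j jK].
- rewrite jet_at_creation0; first exact: eqmod_refl.
  by move=> [a b]; apply/eqP => -[].
- have [ijK|Kij] := ltnP (i + j).+1 K.
    by rewrite jet_at_W//; exact: eqmod_refl.
  rewrite jet_at_high ?addnS//; apply/eqmod_sym/jet_at_top => //.
  exact: eqmod_var.
- apply: jet_at_top; last exact: eqmod_var.
  by apply: leq_trans jK _; rewrite ltnS leq_addl.
Qed.

Lemma jet_vacuum : eqmod K (jet vac) 1.
Proof.
have [K0|K0] := posnP K; first by rewrite K0.
have j00 : jet_at 0 0 vac = 1.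
  by rewrite (@jet_at_word [::] [::] K0) /monomial !big_nil mulr1.
have jij i j : (i, j) != (0, 0)%N -> jet_at i j vac = 0.
  move=> ij; rewrite -(jet_at0 i j); apply: jet_at_eq.
  by rewrite /vacuum /inc [LHS]dfwith_out// eq_sym.
rewrite /jet (@sum_ord_first _ K (fun i => \sum_(j < K) jet_at i j vac))//.
  rewrite (@sum_ord_first _ K (fun j => jet_at 0 j vac))// ?j00 => [|j j0].
    exact: eqmod_refl.
  by apply: jij; apply/eqP => -[jE]; rewrite jE in j0.
move=> i i0; rewrite big1// => j _; apply: jij; apply/eqP => -[iE].
by rewrite iE in i0.
Qed.

Lemma jet_bounded b : exists2 c : R, 0 <= c &
  forall xi, cabs (mcoeff b (jet xi)) <= c * fnorm xi.
Proof.
have /choice[c cP] : forall ij : nat * nat, exists c : R, 0 <= c /\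
    forall xi, cabs (mcoeff b (jet_at ij.1 ij.2 xi)) <= c * fnorm xi.
  move=> [i j].
  have [|c c0 cb] := @linear_functional_bounded R (X (i, j))
      (fun y => mcoeff b (jet_at i j (inc y))).
    by move=> a x y; rewrite inc_linear jet_at_lin mcoeffD mcoeffZ.
  exists c; split=> // xi; rewrite jet_at_inc; apply: cb.
    exact: fnorm_ge0.
  exact: hnorm2_le_fnorm.
exists (\sum_(i < K) \sum_(j < K) c (val i, val j)).
  apply: sumr_ge0 => i _; apply: sumr_ge0 => j _.
  by have [] := cP (val i, val j).
move=> xi; rewrite /jet raddf_sum mulr_suml; apply: (le_trans (cabs_sum _ _ _)).
apply: ler_sum => i _; rewrite raddf_sum mulr_suml.
apply: (le_trans (cabs_sum _ _ _)); apply: ler_sum => j _.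
by have [_ h] := cP (val i, val j); exact: h.
Qed.

End Jet.

(** * Continuous functionals on the tensor algebra *)

Section ContinuousFunctionals.
Variables (R : realType) (X : subproduct_system R).
Local Notation C := R[i].
Local Notation op := (fock X -> fock X).
Local Notation A := (tensor_algebra (X := X)).
Implicit Types F G : op -> C.

Definition continuous_functional F :=
  (forall S T, A S -> A T -> F (S - T) = F S - F T) /\
  exists2 K : R, 0 <= K & forall T, A T -> cabs (F T) <= K * opnorm T.

Lemma continuous_functionalB F G : continuous_functional F ->
  continuous_functional G -> continuous_functional (fun T => F T - G T).
Proof.
move=> [FB [K K0 FK]] [GB [L L0 GL]]; split.
  by move=> S T AS AT; rewrite FB// GB// !opprD !opprK addrACA.
exists (K + L) => [|T AT]; first exact: addr_ge0.
apply: (le_trans (cabsD _ _)); rewrite mulrDl; apply: lerD; first exact: FK.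
by rewrite /cabs normrN; exact: GL.
Qed.

Lemma continuous_functional_sum (I : Type) (r : seq I) (P : pred I) (c : I -> C)
    (F : I -> op -> C) : (forall i, continuous_functional (F i)) ->
  continuous_functional (fun T => \sum_(i <- r | P i) c i * F i T).
Proof.
move=> Fc; split.
  move=> S T AS AT; rewrite -sumrB; apply: eq_bigr => i _.
  by have [FB _] := Fc i; rewrite FB// mulrBr.
have /choice[K KP] : forall i, exists K : R, 0 <= K /\
    forall T, A T -> cabs (F i T) <= K * opnorm T.
  by move=> i; have [_ [K K0 FK]] := Fc i; exists K.
exists (\sum_(i <- r | P i) cabs (c i) * K i).
  apply: sumr_ge0 => i _; apply: mulr_ge0; first exact: cabs_ge0.
  by have [] := KP i.
move=> T AT; rewrite mulr_suml; apply: (le_trans (cabs_sum _ _ _)).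
apply: ler_sum => i _; rewrite cabsM -mulrA; apply: ler_wpM2l.
  exact: cabs_ge0.
by have [_] := KP i; exact.
Qed.

(** Makes induction on the tensor algebra applicable to identities between
continuous functionals. *)
Lemma norm_closed_kernel (I : Type) (F : I -> op -> C) :
  (forall i, continuous_functional (F i)) ->
  norm_closed [set T | A T /\ forall i, F i T = 0].
Proof.
move=> Fc T bT Te; have AT : A T.
  apply: tensor_algebra_closed => // e /Te[S [AS _] Se]; by exists S.
split=> // i; have [FB [K K0 FK]] := Fc i; apply: cabs_eq0 => e e0.
have K1 : 0 < K + 1 by rewrite ltr_wpDl.
have [S [AS FS] /ltW Se] := Te _ (divr_gt0 e0 K1).
have -> : F i T = F i (T - S) by rewrite FB// FS subr0.
apply: (le_trans (FK _ (tensor_algebraB AT AS))).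
move: Se; rewrite ler_pdivlMr// mulrDr mulr1.
by have := opnorm_ge0 (T - S); nra.
Qed.

Lemma character_continuous alpha :
  is_character (X := X) alpha -> continuous_functional alpha.
Proof.
move=> ac; have [aD aZ _ _] := ac; split => [S T AS AT|].
  have := aD _ _ AS (tensor_algebraZ (-1) AT).
  by rewrite (aZ _ _ AT) mulN1r scaleN1r.
by exists 1 => // T AT; rewrite mul1r; exact: character_le.
Qed.

(** At the vector eta with coefficients conj(z_i) the bound for characters
reads |z|^2 <= |z|. *)
Lemma character_contractive s alpha (e : (hdim (X s)).-tuple (X s)) :
  is_character alpha -> is_onb e ->
  l2norm (fun i => alpha (creation (tnth e i))) <= 1.
Proof.
move=> ac eb; have [aD aZ _ _] := ac.
pose z i := alpha (creation (tnth e i)).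
pose eta := \sum_i (z i)^* *: tnth e i.
pose c : C := \sum_i `|z i| ^+ 2.
have aeta : alpha (creation eta) = c.
  rewrite /eta creation_sum.
  have A0 := @tensor_algebra0 _ X.
  have a0 : alpha 0 = 0 by rewrite -(scale0r (0 : op)) (aZ _ _ A0) mul0r.
  suff [] : A (\sum_i (z i)^* *: creation (tnth e i)) /\
    alpha (\sum_i (z i)^* *: creation (tnth e i)) = c by [].
  rewrite /c; elim/big_rec2: _ => [//|i y T _ [AT <-]].
  have Ai := tensor_algebra_creation (tnth e i).
  have Aci := tensor_algebraZ (z i)^* Ai.
  split; first exact: tensor_algebraD.
  by rewrite (aD _ _ Aci AT) (aZ _ _ Ai) normCKC.
have eta2 : (hnorm2 eta)%:C%C = c.
  rewrite -hdotxx (parseval _ _ eb); apply: eq_bigr => i _.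
  rewrite -normCK; congr (_ ^+ 2).
  suff -> : hdot eta (tnth e i) = (z i)^* by rewrite norm_conjC.
  rewrite /eta linear_sumlz (bigD1 i)//= big1 => [|j ji].
    by rewrite linearZl_LR /= onb_dot// eqxx mulr1 addr0.
  by rewrite linearZl_LR /= onb_dot// (negPf ji) mulr0.
have h := character_le ac (tensor_algebra_creation eta).
have {h} h := le_trans h (opnorm_creation eta).
rewrite aeta -eta2 cabs_real ger0_norm ?hnorm2_ge0// in h.
have h1 : hnorm2 eta <= 1.
  rewrite leNgt; apply/negP => lt1.
  have s1 : 1 < Num.sqrt (hnorm2 eta).
    by rewrite -sqrtr1 ltr_sqrt// (lt_trans ltr01).
  have := sqr_sqrtr (hnorm2_ge0 eta); rewrite expr2 => sE.
  by move: h; rewrite -{1}sE; nra.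
rewrite /l2norm -/c -eta2 -(sqrtC1) ler_sqrtC ?nnegrE ?ler01//.
  by rewrite -(rmorph1 (real_complex R)) lecR.
by rewrite ler0c hnorm2_ge0.
Qed.

End ContinuousFunctionals.

(** * The jet homomorphism *)

Section JetHomomorphism.
Variables (R : realType) (X : subproduct_system R).
Local Notation C := R[i].
Local Notation op := (fock X -> fock X).
Local Notation A := (tensor_algebra (X := X)).
Local Notation m := (sp_m X).
Local Notation n := (sp_n X).
Local Notation poly := (mpoly (m + n) C).
Variables (e : m.-tuple (X (1%N, 0%N))) (f : n.-tuple (X (0%N, 1%N))).
Hypotheses (ebase : is_onb e) (fbase : is_onb f).
Variable K : nat.
Hypothesis relK : relations_vanish e f K.
Local Notation jet := (jet ebase fbase relK).
Local Notation vac := (vacuum X).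

Definition vacuum_jet (T : op) : poly := jet (T vac).

Lemma jetD x y : jet (x + y) = jet x + jet y.
Proof. by rewrite -[x]scale1r jet_lin !scale1r. Qed.

Lemma jet0 : jet 0 = 0.
Proof. by apply: (addrI (jet 0)); rewrite -jetD !addr0. Qed.

Lemma jetZ a x : jet (a *: x) = a *: jet x.
Proof. by rewrite -[a *: x]addr0 jet_lin jet0 addr0. Qed.

Lemma jetB x y : jet (x - y) = jet x - jet y.
Proof. by rewrite jetD -scaleN1r jetZ scaleN1r. Qed.

Lemma vacuum_jetD S T : vacuum_jet (S + T) = vacuum_jet S + vacuum_jet T.
Proof. exact: jetD. Qed.

Lemma vacuum_jetZ a T : vacuum_jet (a *: T) = a *: vacuum_jet T.
Proof. exact: jetZ. Qed.

Lemma vacuum_jet_id : eqmod K (vacuum_jet id) 1.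
Proof. exact: jet_vacuum. Qed.

Lemma continuous_jet (xi : fock X) b :
  continuous_functional (fun T : op => mcoeff b (jet (T xi))).
Proof.
split=> [S T _ _|].
  by rewrite -mcoeffB -jetB.
have [c c0 cP] := jet_bounded ebase fbase relK b.
exists (c * fnorm xi) => [|T AT]; first by rewrite mulr_ge0// fnorm_ge0.
apply: (le_trans (cP _)); rewrite -mulrA; apply: ler_wpM2l => //.
by rewrite mulrC; apply: fnorm_op; exact: tensor_algebra_bounded.
Qed.

(** Jets turn the action of the generators on Fock space into multiplication
by the variables; continuity extends this to the whole algebra. *)
Lemma jet_mul S xi : A S -> eqmod K (jet (S xi)) (vacuum_jet S * jet xi).
Proof.
pose F (u : fock X * {b : multinom (m + n) | (mdeg b < K)%N}) (S : op) : C :=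
  let b := sval u.2 in mcoeff b (jet (S u.1)) -
    \sum_(k : bmultinom (m + n) (mdeg b).+1 * bmultinom (m + n) (mdeg b).+1
           | b == mnm_add (bmnm k.1) (bmnm k.2))
    mcoeff (bmnm k.2) (jet u.1) * mcoeff (bmnm k.1) (vacuum_jet S).
have FE xi' b (bK : (mdeg b < K)%N) S' : F (xi', exist _ b bK) S' =
    mcoeff b (jet (S' xi')) - mcoeff b (vacuum_jet S' * jet xi').
  rewrite /F mcoeffM; congr (_ - _); apply: eq_bigr => k _.
  by rewrite mulrC.
have F0 S' : (forall u, F u S' = 0) <->
    forall xi', eqmod K (jet (S' xi')) (vacuum_jet S' * jet xi').
  split=> [S0 xi' b bK|SK [xi' [b bK]]].
    by apply/eqP; rewrite -subr_eq0 -FE S0.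
  by rewrite FE SK// subrr.
(* Written as the kernel of continuous functionals, with the product expanded
   into coefficients, the claim passes to norm limits. *)
pose P := [set T | A T /\ forall u, F u T = 0].
suff AP : A `<=` P by move=> AS; have [_ /F0] := AP _ AS; exact.
have [Abd A0 AD AZ AM] := @tensor_algebra_operator_algebra _ X.
apply: (tensor_algebra_ind ebase fbase).
- split.
  + by move=> T [AT _]; exact: Abd.
  + split=> //; apply/F0 => xi'.
    have -> : vacuum_jet 0 = 0 by exact: jet0.
    have -> : jet ((0 : op) xi') = 0 by exact: jet0.
    by rewrite mul0r; exact: eqmod_refl.
  + move=> S' T [AS' /F0 S'P] [AT /F0 TP]; split; first exact: AD.
    apply/F0 => xi'; rewrite vacuum_jetD mulrDl.
    rewrite -[(S' + T) xi']/(S' xi' + T xi') jetD.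
    exact: eqmodD.
  + move=> a T [AT /F0 TP]; split; first exact: AZ.
    apply/F0 => xi'; rewrite vacuum_jetZ -scalerAl.
    rewrite -[(a *: T) xi']/(a *: T xi') jetZ.
    exact: eqmodZ.
  + move=> S' T [AS' /F0 S'P] [AT /F0 TP]; split; first exact: AM.
    apply/F0 => xi'; apply: eqmod_trans (S'P (T xi')) _.
    apply: eqmod_trans (eqmodM (eqmod_refl _) (TP xi')) _.
    rewrite mulrA; apply: eqmodM (eqmod_refl _).
    exact/eqmod_sym/S'P.
- apply: norm_closed_kernel => -[xi' [b bK]].
  apply: continuous_functionalB; first exact: continuous_jet.
  by apply: continuous_functional_sum => k; exact: continuous_jet.
- split; first exact: tensor_algebra_id.
  apply/F0 => xi'; rewrite -[X in eqmod _ X]mul1r; apply: eqmodM (eqmod_refl _).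
  exact/eqmod_sym/vacuum_jet_id.
- move=> k; split; first exact: tensor_algebra_creation.
  apply/F0 => xi'; apply: eqmod_trans (jet_Z ebase fbase relK k xi') _.
  apply: eqmodM (eqmod_refl _); apply: eqmod_sym.
  apply: eqmod_trans (jet_Z ebase fbase relK k vac) _.
  rewrite -[X in eqmod _ _ X]mulr1.
  exact: eqmodM (eqmod_refl _) (jet_vacuum ebase fbase relK).
- move=> l; split; first exact: tensor_algebra_creation.
  apply/F0 => xi'; apply: eqmod_trans (jet_W ebase fbase relK l xi') _.
  apply: eqmodM (eqmod_refl _); apply: eqmod_sym.
  apply: eqmod_trans (jet_W ebase fbase relK l vac) _.
  rewrite -[X in eqmod _ _ X]mulr1.
  exact: eqmodM (eqmod_refl _) (jet_vacuum ebase fbase relK).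
Qed.

Lemma vacuum_jetM S T : A S ->
  eqmod K (vacuum_jet (S \o T)) (vacuum_jet S * vacuum_jet T).
Proof. exact: jet_mul. Qed.

Lemma vacuum_jet_Z k : eqmod K (vacuum_jet (creation (tnth e k))) (zvar k).
Proof.
apply: eqmod_trans (jet_Z ebase fbase relK k vac) _.
rewrite -[X in eqmod _ _ X]mulr1.
exact: eqmodM (eqmod_refl _) (jet_vacuum ebase fbase relK).
Qed.

Lemma vacuum_jet_W l : eqmod K (vacuum_jet (creation (tnth f l))) (wvar l).
Proof.
apply: eqmod_trans (jet_W ebase fbase relK l vac) _.
rewrite -[X in eqmod _ _ X]mulr1.
exact: eqmodM (eqmod_refl _) (jet_vacuum ebase fbase relK).
Qed.

Lemma continuous_vacuum_jet b :
  continuous_functional (fun T : op => mcoeff b (vacuum_jet T)).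
Proof. exact: continuous_jet. Qed.

(** A continuous character is determined by its values in degree one. *)
Lemma vacuum_character_jet alpha : (0 < K)%N -> vacuum_character alpha ->
  forall T, A T -> alpha T = mcoeff (mnm0 (n := m + n)) (vacuum_jet T).
Proof.
move=> K0 [ac aE aF] T AT; have [aD aZ aM _] := ac.
pose F (u : unit) (S : op) :=
  alpha S - mcoeff (mnm0 (n := m + n)) (vacuum_jet S).
pose P := [set S | A S /\ forall u, F u S = 0].
suff AP : A `<=` P.
  by have [_ /(_ tt) h] := AP _ AT; apply/eqP; rewrite -subr_eq0; apply/eqP.
have deg0 : (mdeg (mnm0 (n := m + n)) < K)%N by rewrite mdeg0.
have FP S : A S -> alpha S = mcoeff (mnm0 (n := m + n)) (vacuum_jet S) -> P S.
  by move=> AS aS; split=> // u; rewrite /F aS subrr.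
have PF S : P S -> alpha S = mcoeff (mnm0 (n := m + n)) (vacuum_jet S).
  by case=> _ /(_ tt) /eqP; rewrite subr_eq0 => /eqP.
have [Abd A0 AD AZ AM] := @tensor_algebra_operator_algebra _ X.
have var0 (i : 'I_(m + n)) :
    mcoeff (mnm0 (n := m + n)) (mpolyX C (mnm1 i)) = 0.
  by rewrite mcoeffX -mdeg_eq0 mdeg1.
apply: (tensor_algebra_ind ebase fbase).
- split.
  + by move=> S [AS _]; exact: Abd.
  + apply: FP => //; rewrite -(scale0r (0 : op)) (aZ _ _ A0) mul0r vacuum_jetZ.
    by rewrite mcoeffZ mul0r.
  + move=> S S' PS PS'; have [AS _] := PS; have [AS' _] := PS'.
    apply: FP; first exact: AD.
    by rewrite (aD _ _ AS AS') vacuum_jetD mcoeffD (PF _ PS) (PF _ PS').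
  + move=> a S PS; have [AS _] := PS; apply: FP; first exact: AZ.
    by rewrite (aZ _ _ AS) vacuum_jetZ mcoeffZ (PF _ PS).
  + move=> S S' PS PS'; have [AS _] := PS; have [AS' _] := PS'.
    apply: FP; first exact: AM.
    rewrite (aM _ _ AS AS') (vacuum_jetM S' AS deg0) (PF _ PS) (PF _ PS').
    by rewrite !mcoeff0_meval mevalM.
- apply: norm_closed_kernel => u; apply: continuous_functionalB.
    exact: character_continuous.
  exact: continuous_vacuum_jet.
- apply: FP; first exact: tensor_algebra_id.
  by rewrite (character_id ac) (vacuum_jet_id deg0) mcoeff1 eqxx.
- move=> k; apply: FP; first exact: tensor_algebra_creation.
  by rewrite aE (vacuum_jet_Z k deg0) var0.
- move=> l; apply: FP; first exact: tensor_algebra_creation.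
  by rewrite aF (vacuum_jet_W l deg0) var0.
Qed.

End JetHomomorphism.

(** * Relations below the minimal degree *)

Section LowRelations.
Variables (R : realType) (X : subproduct_system R).
Local Notation C := R[i].
Local Notation m := (sp_m X).
Local Notation n := (sp_n X).

Section Bases.
Variables (e : m.-tuple (X (1%N, 0%N))) (f : n.-tuple (X (0%N, 1%N))).
Hypotheses (ebase : is_onb e) (fbase : is_onb f).
Local Notation vac := (vacuum X).

(** In total degree at most one the words are the vacuum and the given
orthonormal bases, so there are no linear relations between them. *)
Lemma word_orthonormal i j (s s' : i.-tuple 'I_m) (t t' : j.-tuple 'I_n) :
  (i + j < 2)%N ->
  hdot (fock_val (word e f s t vac) (i, j))
       (fock_val (word e f s' t' vac) (i, j)) = ((s, t) == (s', t'))%:R.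
Proof.
case: i j s s' t t' => [|[|//]] [|[|//]] s s' t t' // _.
- rewrite (tuple0 s) (tuple0 s') (tuple0 t) (tuple0 t') eqxx.
  by rewrite [word _ _ _ _ _]/(inc (sp_one X)) inc_in sp_one1.
- rewrite (tuple0 s) (tuple0 s').
  case/tupleP: t => l t; case/tupleP: t' => l' t'.
  rewrite (tuple0 t) (tuple0 t') xpair_eqE eqxx -val_eqE eqseq_cons andbT.
  have wE x : word e f [::] [:: x] vac = inc (tnth f x).
    exact: creation_vacuum.
  transitivity (hdot (fock_val (inc (tnth f l)) (0, 1)%N)
    (fock_val (inc (tnth f l')) (0, 1)%N)); first by rewrite -!wE.
  by rewrite !inc_in onb_dot.
- rewrite (tuple0 t) (tuple0 t').
  case/tupleP: s => k s; case/tupleP: s' => k' s'.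
  rewrite (tuple0 s) (tuple0 s') xpair_eqE eqxx -val_eqE eqseq_cons !andbT.
  have wE x : word e f [:: x] [::] vac = inc (tnth e x).
    exact: creation_vacuum.
  transitivity (hdot (fock_val (inc (tnth e k)) (1, 0)%N)
    (fock_val (inc (tnth e k')) (1, 0)%N)); first by rewrite -!wE.
  by rewrite !inc_in onb_dot.
Qed.

Lemma low_relation i j (a : i.-tuple 'I_m -> j.-tuple 'I_n -> C) :
  (i + j < 2)%N -> \sum_s \sum_t a s t *: word e f s t vac = 0 ->
  q_poly a = 0.
Proof.
move=> ij aw; suff a0 s t : a s t = 0.
  by rewrite /q_poly big1// => s _; rewrite big1// => t _; rewrite a0 scale0r.
pose v s t : X (i, j) := fock_val (word e f s t vac) (i, j).
have fsum (I : finType) (g : I -> fock X) :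
    fock_val (\sum_x g x) (i, j) = \sum_x fock_val (g x) (i, j).
  by elim/big_rec2: _ => // x y z _ <-.
have vw : \sum_s \sum_t a s t *: v s t = 0.
  transitivity (fock_val (\sum_s \sum_t a s t *: word e f s t vac) (i, j)).
    by rewrite fsum; apply: eq_bigr => s' _; rewrite fsum.
  by rewrite aw.
have := linear0l (hdot (V := X (i, j))) (v s t); rewrite -vw.
rewrite linear_sumlz (bigD1 s)//= linear_sumlz (bigD1 t)//= big1 => [|t' t't].
  rewrite big1 => [|s' s's].
    by rewrite !addr0 linearZl_LR /= word_orthonormal// eqxx mulr1.
  rewrite linear_sumlz big1// => t' _.
  rewrite linearZl_LR /= word_orthonormal// xpair_eqE.
  by rewrite (negPf s's) mulr0.
rewrite linearZl_LR /= word_orthonormal// xpair_eqE.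
by rewrite (negPf t't) andbF mulr0.
Qed.

Lemma relations_vanish2 : relations_vanish e f 2.
Proof. by split=> // i j a; exact: low_relation. Qed.

End Bases.

Variable B : frame X.
Local Notation e := (frame_e B).
Local Notation f := (frame_f B).
Local Notation poly := (mpoly (m + n) C).

Lemma min_degree_le (I : set poly) d (p : poly) : (0 < d)%N -> I p ->
  p != 0 -> p \is ishomog1 d (@mdeg (m + n)) ->
  (min_degree I <= (d%:R : R)%:E)%E.
Proof.
move=> d0 Ip p0 pd; apply: ereal_inf_lbound; exists d => //; split=> //.
exists p; split=> //; apply: esym.
exact: (dhomog_uniq p0 pd (dhomog_msize pd)).
Qed.

Lemma var_homog (i : 'I_(m + n)) :
  mpolyX C (mnm1 i) \is ishomog1 1 (@mdeg (m + n)).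
Proof. by rewrite dhomogX; apply/eqP; exact: mdeg1. Qed.

Lemma var_prod_homog (I : Type) (s : seq I) (g : I -> 'I_(m + n)) :
  \prod_(i <- s) mpolyX C (mnm1 (g i)) \is ishomog1 (size s) (@mdeg (m + n)).
Proof.
elim: s => [|i s IHs]; first by rewrite big_nil; exact: dhomog1.
by rewrite big_cons; exact: (dhomogM (var_homog (g i)) IHs).
Qed.

Lemma q_poly_homog i j (a : i.-tuple 'I_m -> j.-tuple 'I_n -> C) :
  q_poly a \is ishomog1 (i + j) (@mdeg (m + n)).
Proof.
apply: rpred_sum => s _; apply: rpred_sum => t _; apply: rpredZ.
have := dhomogM (var_prod_homog s (@lshift m n))
  (var_prod_homog t (@rshift m n)).
by rewrite !size_tuple.
Qed.

Lemma commutation_poly_homog i j :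
  commutation_poly B i j \is ishomog1 2 (@mdeg (m + n)).
Proof.
apply: rpredB; first exact: dhomogM (var_homog _) (var_homog _).
apply: rpred_sum => k _; apply: rpred_sum => l _; apply: rpredZ.
exact: dhomogM (var_homog _) (var_homog _).
Qed.

(** The generators of the ideal are homogeneous, so one of degree d below the
minimal degree is zero; degrees 0 and 1 carry no relations at all. *)
Lemma relations_vanish_min_degree K :
  (forall d, (1 < d < K)%N -> ((d%:R : R)%:E < min_degree (J_ideal B))%E) ->
  relations_vanish e f K.
Proof.
move=> Kmin; split=> [i j a ijK aw|K2 i j].
  have [ij2|ij2] := ltnP (i + j) 2.
    apply: (@low_relation e f _ _ i j a ij2 aw); first exact: frame_eP.
    exact: frame_fP.
  apply/eqP; rewrite -[_ == _]negbK; apply/negP => q0.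
  have aker : ker_M B a.
    pose z (s : i.-tuple 'I_m) (t : j.-tuple 'I_n) :=
      sp_M i j [seq tnth e k | k <- s] [seq tnth f l | l <- t].
    have sum_inc (I : finType) q (c : I -> C) (x : I -> X q) :
        inc (\sum_x0 c x0 *: x x0) = \sum_x0 c x0 *: inc (x x0).
      elim/big_rec2: _ => [|x0 y0 y1 _ <-]; first exact: inc0.
      exact: inc_linear.
    rewrite /ker_M; apply: (@inc_injective R X ((i, 0%N) + (0%N, j))%R).
    apply: etrans _ (esym (inc0 X _)); rewrite -aw.
    transitivity (inc (\sum_s 1 *: \sum_t a s t *: z s t)).
      by congr inc; apply: eq_bigr => s _; rewrite scale1r.
    rewrite sum_inc; apply: eq_bigr => s _.
    rewrite scale1r sum_inc; apply: eq_bigr => t _.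
    by rewrite (word_vacuum e f (size_tuple s) (size_tuple t)).
  have Jq : J_ideal B (q_poly a).
    by move=> I [_ gI]; apply: gI; right; exists i, j, a.
  have := min_degree_le (ltnW ij2) Jq q0 (q_poly_homog a).
  by rewrite leNgt Kmin// ij2.
exists (fun k l => u_coef B k l i j); split; first exact: creation_commutation.
apply/eqP; rewrite -subr_eq0 -/(commutation_poly B i j).
rewrite -[_ == _]negbK; apply/negP => p0.
have Jp : J_ideal B (commutation_poly B i j).
  by move=> I [_ gI]; apply: gI; left; exists i, j.
have := min_degree_le (isT : (0 < 2)%N) Jp p0 (commutation_poly_homog i j).
by rewrite leNgt Kmin.
Qed.

End LowRelations.

(** * Pulling jets back along an isomorphism *)

Lemma right_inverse_of_injective (F : fieldType) p q (D : 'M[F]_(p, q)) :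
  (forall c : 'cV_q, D *m c = 0 -> c = 0) ->
  (q <= p)%N /\ (p = q -> exists E : 'M_(q, p), D *m E = 1%:M).
Proof.
move=> Dinj; have Dq : \rank D = q.
  apply/eqP; rewrite -mxrank_tr -/(row_free D^T) -kermx_eq0.
  apply/eqP/row_matrixP => i; rewrite row0; apply: trmx_inj; rewrite trmx0.
  by apply/Dinj/trmx_inj; rewrite trmx_mul trmxK -row_mul mulmx_ker row0 trmx0.
split=> [|pq]; first by rewrite -Dq rank_leq_row.
by exists (pinvmx D); apply: mulmxVp; rewrite /row_free Dq pq.
Qed.

Section Pullback.
Variables (R : realType) (X Y : subproduct_system R).
Local Notation C := R[i].
Local Notation opX := (fock X -> fock X).
Local Notation opY := (fock Y -> fock Y).
Local Notation A := (tensor_algebra (X := X)).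
Variable phi : opX -> opY.
Hypothesis phi_iso : bounded_isomorphism phi.

Lemma isomorphism_mem T : A T -> tensor_algebra (phi T).
Proof. by case: phi_iso => -[h _ _] _ _ _ _; exact: h. Qed.

Lemma isomorphism_id : phi id = id.
Proof.
have [[_ _ surj] _ _ pM _] := phi_iso.
have [T AT Tid] := surj _ (@tensor_algebra_id _ Y).
have h : phi T = phi id \o phi T := pM _ _ (@tensor_algebra_id _ X) AT.
by rewrite Tid in h; exact: esym h.
Qed.

Lemma isomorphism_character alpha : is_character (X := Y) alpha ->
  is_character (X := X) (alpha \o phi).
Proof.
have [_ pD pZ pM _] := phi_iso; have pA := isomorphism_mem.
move=> ac; have [aD aZ aM _] := ac; split => [S T AS AT|a S AS|S T AS AT|].
- by rewrite /= pD// aD//; exact: pA.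
- by rewrite /= pZ// aZ//; exact: pA.
- by rewrite /= pM// aM//; exact: pA.
- exists id; first exact: tensor_algebra_id.
  by rewrite /= isomorphism_id (character_id ac) oner_eq0.
Qed.

Lemma continuous_functional_pullback F : continuous_functional (X := Y) F ->
  continuous_functional (X := X) (F \o phi).
Proof.
have [_ pD pZ _ [M phiM]] := phi_iso; have pA := isomorphism_mem.
case=> FB [K K0 FK]; split => [S T AS AT|].
  rewrite /= -FB; [|exact: pA..]; congr F.
  rewrite -scaleN1r pD//; last exact: tensor_algebraZ.
  by rewrite pZ// scaleN1r.
exists (K * `|M|) => [|T AT]; first by rewrite mulr_ge0.
apply: (le_trans (FK _ (pA _ AT))); rewrite -mulrA; apply: ler_wpM2l => //.
apply: (le_trans (phiM _ AT)); apply: ler_wpM2r (opnorm_ge0 T) _ _ _.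
exact: ler_norm.
Qed.

Local Notation mX := (sp_m X).
Local Notation nX := (sp_n X).
Local Notation mY := (sp_m Y).
Local Notation nY := (sp_n Y).
Variables (eX : mX.-tuple (X (1%N, 0%N))) (fX : nX.-tuple (X (0%N, 1%N))).
Variables (eY : mY.-tuple (Y (1%N, 0%N))) (fY : nY.-tuple (Y (0%N, 1%N))).
Hypotheses (eXb : is_onb eX) (fXb : is_onb fX).
Hypotheses (eYb : is_onb eY) (fYb : is_onb fY).
Variable K : nat.
Hypothesis relK : relations_vanish eY fY K.

(** The jet homomorphism of Y carried over to X. *)
Definition pullback (T : opX) : mpoly (mY + nY) C :=
  vacuum_jet eYb fYb relK (phi T).

Local Notation Psi := pullback.
Local Notation G := (generator_values eX fX Psi).

Lemma pullbackD S T : A S -> A T -> Psi (S + T) = Psi S + Psi T.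
Proof.
move=> AS AT; have [_ pD _ _ _] := phi_iso.
by rewrite /pullback pD// vacuum_jetD.
Qed.

Lemma pullbackZ a T : A T -> Psi (a *: T) = a *: Psi T.
Proof.
by move=> AT; have [_ _ pZ _ _] := phi_iso; rewrite /pullback pZ// vacuum_jetZ.
Qed.

Lemma pullback_id : eqmod K (Psi id) 1.
Proof. by rewrite /pullback isomorphism_id; exact: vacuum_jet_id. Qed.

Lemma pullbackM S T : A S -> A T -> eqmod K (Psi (S \o T)) (Psi S * Psi T).
Proof.
move=> AS AT; have [_ _ _ pM _] := phi_iso.
by rewrite /pullback pM//; apply: vacuum_jetM; exact: isomorphism_mem.
Qed.

(** Jets of first order of the images of the generators of X: a functional
killing all of them kills the jets of the whole algebra, by the Leibniz rule
and continuity, hence vanishes as phi is onto. *)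
Lemma linear_part_separates (c : 'I_(mY + nY) -> C) : (1 < K)%N ->
  (forall i, \sum_l mcoeff (mnm1 l) (G i) * c l = 0) -> forall l, c l = 0.
Proof.
move=> K1 Gc; have K0 : (0 < K)%N by exact: ltnW.
have d0 : (mdeg (mnm0 (n := mY + nY)) < K)%N by rewrite mdeg0.
have d1 l : (mdeg (mnm1 (n := mY + nY) l) < K)%N by rewrite mdeg1.
pose lin (p : mpoly (mY + nY) C) := \sum_l c l * mcoeff (mnm1 l) p.
have linD p q : lin (p + q) = lin p + lin q.
  by rewrite /lin -big_split; apply: eq_bigr => l _; rewrite mcoeffD mulrDr.
have linZ a p : lin (a *: p) = a * lin p.
  by rewrite /lin mulr_sumr; apply: eq_bigr => l _; rewrite mcoeffZ mulrCA.
have lin_eqmod p q : eqmod K p q -> lin p = lin q.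
  by move=> pq; apply: eq_bigr => l _; rewrite pq.
have lin1 : lin 1 = 0.
  by rewrite /lin big1// => l _; rewrite mcoeff1 -mdeg_eq0 mdeg1 mulr0.
have linM p q : lin (p * q) = mcoeff (mnm0 (n := mY + nY)) p * lin q +
    lin p * mcoeff (mnm0 (n := mY + nY)) q.
  rewrite /lin mulr_sumr mulr_suml -big_split; apply: eq_bigr => l _.
  have h (r : mpoly (mY + nY) C) :
      mcoeff (mnm1 l) r = mcoeff (mnm0 (n := mY + nY)) (mderiv l r).
    by rewrite mcoeff_mderiv mnm0E mulr1n add0m.
  rewrite !h mderivM mcoeffD !mcoeff0_meval !mevalM mulrDr addrC.
  by congr (_ + _); [exact: mulrCA|exact: mulrA].
pose F (u : unit) (T : opX) := lin (Psi T).
have Fcont u : continuous_functional (F u).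
  apply: continuous_functional_sum => l.
  exact: continuous_functional_pullback (continuous_vacuum_jet eYb fYb relK _).
have G0 i : lin (G i) = 0.
  by rewrite -[RHS](Gc i); apply: eq_bigr => l _; rewrite mulrC.
pose P := [set T | A T /\ forall u, F u T = 0].
have [Abd A0 AD AZ AM] := @tensor_algebra_operator_algebra _ X.
have AP : A `<=` P.
  apply: (tensor_algebra_ind eXb fXb).
  - split.
    + by move=> T [AT _]; exact: Abd.
    + split=> // u; rewrite /F -(scale0r (0 : opX)) pullbackZ// linZ.
      by rewrite mul0r.
    + move=> S T [AS S0] [AT T0]; split; first exact: AD.
      move=> u; rewrite /F pullbackD// linD.
      by rewrite [lin (Psi S)](S0 u) [lin (Psi T)](T0 u) addr0.
    + move=> a T [AT T0]; split; first exact: AZ.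
      by move=> u; rewrite /F pullbackZ// linZ [lin (Psi T)](T0 u) mulr0.
    + move=> S T [AS S0] [AT T0]; split; first exact: AM.
      move=> u; rewrite /F (lin_eqmod _ _ (pullbackM AS AT)) linM.
      by rewrite [lin (Psi S)](S0 u) [lin (Psi T)](T0 u) mulr0 mul0r addr0.
  - exact: norm_closed_kernel.
  - split; first exact: tensor_algebra_id.
    by move=> u; rewrite /F (lin_eqmod _ _ pullback_id).
  - move=> k; split; first exact: tensor_algebra_creation.
    by move=> u; rewrite /F -(generator_values_l eX fX Psi).
  - move=> k; split; first exact: tensor_algebra_creation.
    by move=> u; rewrite /F -(generator_values_r eX fX Psi).
have [[_ _ surj] _ _ _ _] := phi_iso.
have lin_jet S : tensor_algebra (X := Y) S ->
    lin (vacuum_jet eYb fYb relK S) = 0.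
  move=> /surj[T AT <-]; have [_ h] := AP _ AT; exact: h tt.
have lin_var (i : 'I_(mY + nY)) : lin (mpolyX C (mnm1 i)) = c i.
  rewrite /lin (bigD1 i)//= mcoeffXU eqxx mulr1 big1 ?addr0// => l li.
  by rewrite mcoeffXU eq_sym (negPf li) mulr0.
move=> l; rewrite -(splitK l); case: (fintype.split l) => i /=.
- rewrite -lin_var -(lin_eqmod _ _ (vacuum_jet_Z eYb fYb relK i)).
  by apply: lin_jet; exact: tensor_algebra_creation.
- rewrite -lin_var -(lin_eqmod _ _ (vacuum_jet_W eYb fYb relK i)).
  by apply: lin_jet; exact: tensor_algebra_creation.
Qed.

(** The Jacobian of G at the origin is injective on columns; it is invertible
once the dimensions agree. *)
Lemma linear_part_rank : (1 < K)%N -> (mY + nY <= mX + nX)%N /\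
  ((mX + nX = mY + nY)%N -> exists E : 'I_(mY + nY) -> 'I_(mX + nX) -> C,
    forall i j, \sum_l mcoeff (mnm1 l) (G i) * E l j = (i == j)%:R).
Proof.
move=> K1; pose D := \matrix_(i, l) mcoeff (mnm1 l) (G i).
have [c Dc|le_YX inv] := @right_inverse_of_injective C _ _ D.
  apply/colP => l; rewrite mxE.
  apply: (@linear_part_separates (fun l => c l 0)) => // i.
  have := congr1 (fun M : 'cV_(mX + nX) => M i 0) Dc.
  rewrite mxE [X in _ = X]mxE; apply: etrans.
  by apply: eq_bigr => l' _; rewrite mxE.
split=> // /inv[E DE]; exists (fun l j => E l j) => i j.
have := congr1 (fun M : 'M_(mX + nX) => M i j) DE.
rewrite mxE [X in _ = X]mxE; apply: etrans.
by apply: eq_bigr => l _; rewrite mxE.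
Qed.

End Pullback.

Lemma dimension_le (R : realType) (X Y : subproduct_system R)
    (phi : (fock X -> fock X) -> (fock Y -> fock Y)) :
  bounded_isomorphism phi -> (sp_m Y + sp_n Y <= sp_m X + sp_n X)%N.
Proof.
move=> phi_iso.
have rel2 := relations_vanish2 (onbP (Y (1%N, 0%N))) (onbP (Y (0%N, 1%N))).
by have [] := linear_part_rank phi_iso (onbP (X (1%N, 0%N)))
  (onbP (X (0%N, 1%N))) (onbP (Y (1%N, 0%N))) (onbP (Y (0%N, 1%N))) rel2 isT.
Qed.

(** * Dimensions and root multiplicities *)

Theorem theorem6p3 (R : realType) (X Y : subproduct_system R)
  (phi : (fock X -> fock X) -> (fock Y -> fock Y)) :
  bounded_isomorphism phi ->
  (sp_m X + sp_n X = sp_m Y + sp_n Y)%N /\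
  (forall (B : frame X) (D : frame Y) (alpha0 : (fock Y -> fock Y) -> R[i]),
    vacuum_character alpha0 ->
    Omega B (char_point B (alpha0 \o phi)) /\
    forall p, J_ideal B p ->
      root_multiplicity_ge (min_degree (J_ideal D)) p
        (char_point B (alpha0 \o phi))).
Proof.
move=> phi_iso; have dimE : (sp_m X + sp_n X = sp_m Y + sp_n Y)%N.
  apply/eqP; rewrite eqn_leq (dimension_le phi_iso).
  by have [psi /dimension_le ->] := bounded_isomorphism_inverse phi_iso.
split=> // B D alpha0 vac0; have [ac _ _] := vac0.
have eXb := frame_eP B; have fXb := frame_fP B.
have eYb := frame_eP D; have fYb := frame_fP D.
(* The point of the vacuum character is the value at 0 of the map G of jets. *)
have pointE K (relK : relations_vanish (frame_e D) (frame_f D) K) :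
    (0 < K)%N -> char_point B (alpha0 \o phi) =1
    fun i => mcoeff (mnm0 (n := sp_m Y + sp_n Y)) (generator_values (frame_e B)
      (frame_f B) (pullback phi eYb fYb relK) i).
  move=> K0 i; rewrite /char_point /generator_values.
  have h T : tensor_algebra T -> (alpha0 \o phi) T =
      mcoeff (mnm0 (n := sp_m Y + sp_n Y)) (pullback phi eYb fYb relK T).
    move=> AT; apply: (vacuum_character_jet eYb fYb relK K0 vac0).
    exact: isomorphism_mem.
  by case: (fintype.split i) => k; apply: h; exact: tensor_algebra_creation.
have vanish K (relK : relations_vanish (frame_e D) (frame_f D) K) p :
    J_ideal B p -> eqmod K (subst (generator_values (frame_e B)
      (frame_f B) (pullback phi eYb fYb relK)) p) 0.
  apply: J_ideal_vanish.
  - exact: pullbackD.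
  - exact: pullbackZ.
  - exact: pullback_id.
  - exact: pullbackM.
split.
  have acX := isomorphism_character phi_iso ac.
  split=> [p Jp||].
  - have rel2 := relations_vanish2 eYb fYb.
    rewrite (meval_eq _ (pointE _ rel2 isT)) -mcoeff0_subst.
    by rewrite (vanish _ rel2 p Jp) ?mdeg0// mcoeff0.
  - have := character_contractive acX eXb.
    rewrite /l2norm; under eq_bigr do
      rewrite -(generator_values_l (frame_e B) (frame_f B) (alpha0 \o phi)).
    by [].
  - have := character_contractive acX fXb.
    rewrite /l2norm; under eq_bigr do
      rewrite -(generator_values_r (frame_e B) (frame_f B) (alpha0 \o phi)).
    by [].
(* Jets of order at least 2 are needed for the linear part of G. *)
move=> p Jp a ak; pose K := maxn 2 (mdeg a).+1.
have relK : relations_vanish (frame_e D) (frame_f D) K.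
  apply: relations_vanish_min_degree => d /andP[d1 dK]; apply: le_lt_trans ak.
  rewrite lee_fin ler_nat -ltnS; move: dK; rewrite leq_max => /orP[|//].
  by rewrite ltnNge d1.
have K1 : (1 < K)%N by rewrite leq_maxl.
have [_ /(_ dimE)[E GE]] := linear_part_rank phi_iso eXb fXb eYb fYb relK K1.
rewrite (meval_eq _ (pointE _ relK (ltnW K1))).
apply: mderivm_vanish GE (vanish _ relK p Jp) _.
by rewrite leq_max ltnSn orbT.
Qed.
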